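(* Let $\ell=2$, $q$ odd, $4\mid q+\eta$. Let $\tilde R=\tilde R_{m,\alpha,\gamma}$ ($m\ge1$, $\alpha,\gamma\ge0$) or $\tilde R=\tilde R^\pm_{m,0,\gamma}$ ($\gamma>1$ if the type is plus, $\gamma>0$ if the type is minus) be a subgroup of symplectic type of $\tilde G_{m,\alpha,\gamma}=\mathrm{GL}_{m2^{\alpha+\gamma}}(\eta q)$ (with $\alpha=0$ in the second case), and suppose $\tilde R$ is a radical $2$-subgroup. Then $\tilde R$ is special with respect to $\mathrm{SL}_{m2^{\alpha+\gamma}}(\eta q)$ if and only if one of the following holds. (1) $\tilde R=\tilde R_{m,\alpha,\gamma}$ ($\alpha\ge1$) with $\nu(m)+\gamma>0$ or $\alpha=1$. (2) $\tilde R=\tilde R^\pm_{m,0,\gamma}=E^\pm_{m,\gamma}$ ($\gamma>1$ if the type is plus, $\gamma>0$ if the type is minus). (3) $\tilde R=\tilde R_{m,0,\gamma}=\tilde S_{m,1,\gamma-1}$ ($\gamma\ge1$), unless $\nu(m)=0$, $\gamma=1$, $a=2$. (4) $\tilde R=\tilde R_m$.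
   Context: Let $p$ be an odd prime, $q$ a power of $p$, $\eta\in\{1,-1\}$ with $4\mid q+\eta$, $\overline{\mathbb F}$ an algebraic closure of $\mathbb F_q$. On $\mathrm{GL}_N(\overline{\mathbb F})$ let $F$ be $A\mapsto A^{(q)}$ (entrywise $q$-th powers) if $\eta=1$, and $A\mapsto((A^{(q)})^{-1})^t$ if $\eta=-1$. $\mathrm{GL}_N((\eta q)^k)$ denotes the fixed points of $F^k$; so $\mathrm{GL}_N(\eta q)$ is $\mathrm{GL}_N(q)$ or $\mathrm{GU}_N(q)$, and $\mathrm{SL}_N(\eta q)$ is its subgroup of determinant 1. $\nu$ is the $2$-adic valuation, $a=\nu(q+\eta)\ge 2$ (so $2^{a+1}=(q^2-1)_2$). Tensor product of matrices: $A\otimes B=(b_{ij}A)$. Let $x=\mathrm{diag}(1,-1)$, $y=\begin{pmatrix}0&1\\ 1&0\end{pmatrix}$; $x_j,y_j$ ($1\le j\le\gamma$) are the $\gamma$-fold tensor products with $x$, resp. $y$, in position $j$ and $I_2$ elsewhere. Subgroups of symplectic type: - For $\alpha>0$, $\gamma\ge0$: fix $\zeta\in\overline{\mathbb F}^\times$ of order $2^{a+\alpha}$, $R^0=\langle\zeta I_{m2^\gamma},I_m\otimes x_j,I_m\otimes y_j:1\le j\le\gamma\rangle\le\mathrm{GL}_{m2^\gamma}((\eta q)^{2^\alpha})$, $k=2^\alpha$, choose $g_\alpha\in\mathrm{SL}_k(\overline{\mathbb F})$ with $g_\alpha^{-1}F(g_\alpha)=\begin{pmatrix}0&-1\\ I_{k-1}&0\end{pmatrix}$,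 $g=I_{m2^\gamma}\otimes g_\alpha$; $\tilde R_{m,\alpha,\gamma}=\{g\,\mathrm{diag}(A,F(A),\dots,F^{k-1}(A))\,g^{-1}:A\in R^0\}\le\mathrm{GL}_{m2^{\alpha+\gamma}}(\eta q)$. - For $\gamma\ge1$: $\tilde R_{m,0,\gamma}=\tilde S_{m,1,\gamma-1}=\langle\tilde R_{m,1,\gamma-1},\ I_{m2^{\gamma-1}}\otimes g_1\begin{pmatrix}0&1\\ -1&0\end{pmatrix}g_1^{-1}\rangle\le\mathrm{GL}_{m2^\gamma}(\eta q)$ (a central product of an extraspecial group of order $2^{2\gamma-1}$ and a semidihedral group of order $2^{a+2}$). - For $\gamma\ge1$: $\tilde R^+_{m,0,\gamma}=E^+_{m,\gamma}=\langle I_m\otimes x_j,I_m\otimes y_j:1\le j\le\gamma\rangle$ (extraspecial of plus type), and $\tilde R^-_{m,0,\gamma}=E^-_{m,\gamma}=\langle I_m\otimes x_j,\ I_m\otimes y_j\ (1\le j\le\gamma-1),\ I_{m2^{\gamma-1}}\otimes g_1\mathrm{diag}(\zeta_4,\zeta_4^{-1})g_1^{-1},\ I_{m2^{\gamma-1}}\otimes g_1\begin{pmatrix}0&1\\ -1&0\end{pmatrix}g_1^{-1}\rangle$, $\zeta_4$ of order 4 (extraspecial of minus type), both in $\mathrm{GL}_{m2^\gamma}(\eta q)$. - $\tilde R_m=\tilde R_{m,0,0}=\{\pm I_m\}\le\mathrm{GL}_m(\eta q)$. A $2$-subgroup $\tilde R$ of a finite group $\tilde H$ is radical if $\tilde R=\mathrm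 O_2(N_{\tilde H}(\tilde R))$. If $H\unlhd\tilde H$, a radical $2$-subgroup $\tilde R$ of $\tilde H$ is special with respect to $H$ if $\tilde R=\mathrm O_2(N_{\tilde H}(\tilde R\cap H))$. *)

(* Defs.v *)
From HB Require Import structures.
From mathcomp Require Import all_boot all_order all_algebra all_fingroup all_solvable all_field.
From mathcomp Require Import mxtens.

Set Implicit Arguments.
Unset Strict Implicit.
Unset Printing Implicit Defensive.

Import GRing.Theory.
Local Open Scope ring_scope.

Definition castsq (R : Type) (n n' : nat) (e : n = n') (A : 'M[R]_n) : 'M[R]_n' :=
  castmx (e, e) A.

(* The convention is A (x) B = (b_ij A), i.e. B indexes the blocks, whereas the
   library's A *t B is (a_ij B). *)
Definition otimes (R : pzRingType) (m n : nat) (A : 'M[R]_m) (B : 'M[R]_n) :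
    'M[R]_(m * n) :=
  castsq (mulnC n m) (B *t A).

Section FixedPoints.

Variables (Fq : finFieldType) (K : closedFieldType) (FtoK : {rmorphism Fq -> K}).
Variable eta : int.

(* FtoK is unused in the body; it is an argument so that x |-> x ^+ #|Fq| can be
   given its ring morphism structure. *)
Definition frobq of {rmorphism Fq -> K} := fun x : K => x ^+ #|Fq|.

Fact frobq_pnat : [pchar K].-nat #|Fq|.
Proof.
have [p p_pr pcharFp] := finPcharP Fq.
have pcharKp : p \in [pchar K] by rewrite (fmorph_pchar FtoK).
by rewrite (eq_pnat _ (pcharf_eq pcharKp)) (card_pprimeChar pcharFp) pnatX pnat_id.
Qed.

Fact frobq_zmod : zmod_morphism (frobq FtoK).
Proof.
move=> x y; rewrite /frobq.
have e a b : (a + b) ^+ #|Fq| = a ^+ #|Fq| + b ^+ #|Fq| :> K.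
  by rewrite exprDn_pchar // frobq_pnat.
by apply: (addIr (y ^+ #|Fq|)); rewrite -e !subrK.
Qed.

Fact frobq_monoid : monoid_morphism (frobq FtoK).
Proof. by split=> [|x y]; rewrite /frobq ?expr1n ?exprMn. Qed.

HB.instance Definition _ := GRing.isZmodMorphism.Build K K (frobq FtoK) frobq_zmod.
HB.instance Definition _ := GRing.isMonoidMorphism.Build K K (frobq FtoK) frobq_monoid.

(* F : A |-> A^(q) if eta = 1, and A |-> ((A^(q))^-1)^t otherwise (eta = -1). *)
Definition Frob (N : nat) (A : 'M[K]_N) : 'M[K]_N :=
  if eta == 1 then map_mx (frobq FtoK) A else (invmx (map_mx (frobq FtoK) A))^T.

Fact FrobM N (A B : 'M[K]_N) : A \in unitmx -> B \in unitmx ->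
  Frob (A *m B) = Frob A *m Frob B.
Proof.
move=> uA uB; rewrite /Frob map_mxM; case: ifP => // _.
have [uA' uB'] : map_mx (frobq FtoK) A \in unitmx /\ map_mx (frobq FtoK) B \in unitmx.
  by rewrite !map_unitmx.
rewrite -trmx_mul; congr trmx.
have uAB : map_mx (frobq FtoK) A *m map_mx (frobq FtoK) B \in unitmx.
  by rewrite unitmx_mul uA' uB'.
apply: (can_inj (mulmxK uAB)); rewrite mulVmx // -mulmxA (mulKmx uA').
by rewrite mulVmx.
Qed.

Fact Frob_unit N (A : 'M[K]_N) : (Frob A \in unitmx) = (A \in unitmx).
Proof.
by rewrite /Frob; case: ifP; rewrite ?unitmx_tr ?unitmx_inv map_unitmx.
Qed.

Fact Frob1 N : Frob (1%:M : 'M[K]_N) = 1%:M.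
Proof. by rewrite /Frob map_mx1 invmx1 trmx1; case: ifP. Qed.

Fact FrobV N (A : 'M[K]_N) : Frob (invmx A) = invmx (Frob A).
Proof. by rewrite /Frob !map_invmx trmx_inv; case: ifP. Qed.

Fact Frob2 N (A : 'M[K]_N) :
  Frob (Frob A) = map_mx (frobq FtoK) (map_mx (frobq FtoK) A).
Proof.
by rewrite /Frob; case: (eta == 1) => //; rewrite -map_trmx map_invmx -trmx_inv invmxK trmxK.
Qed.

(* GL_N((eta q)^k) for k = 2 ^ e: the fixed points of F^k in GL_N(K). *)
Definition isGLfix (e N : nat) (A : 'M[K]_N) :=
  (A \in unitmx) && (iter (2 ^ e) (@Frob N) A == A).

Record GLfix (e N : nat) : Type := MkGLfix {
  GLfix_mx :> 'M[K]_N;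
  _ : isGLfix e GLfix_mx }.

HB.instance Definition _ e N := [isSub for @GLfix_mx e N].
HB.instance Definition _ e N := [Choice of GLfix e N by <:].

Fact iter_FrobM d N (A B : 'M[K]_N) : A \in unitmx -> B \in unitmx ->
  iter d (@Frob N) (A *m B) = iter d (@Frob N) A *m iter d (@Frob N) B.
Proof.
move=> uA uB; elim: d => //= d ->; apply: FrobM.
  by elim: d => //= d IH; rewrite Frob_unit.
by elim: d => //= d IH; rewrite Frob_unit.
Qed.

Fact GLfix_mul_subproof e N (A B : GLfix e N) : isGLfix e (A *m B).
Proof.
case: A B => [A /andP[uA /eqP fA]] [B /andP[uB /eqP fB]] /=.
by rewrite /isGLfix unitmx_mul uA uB iter_FrobM // fA fB /=.
Qed.

Fact GLfix_one_subproof e N : isGLfix e (1%:M : 'M[K]_N).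
Proof.
rewrite /isGLfix unitmx1; apply/eqP.
by elim: (2 ^ e)%N => //= d ->; rewrite Frob1.
Qed.

Fact GLfix_inv_subproof e N (A : GLfix e N) : isGLfix e (invmx A).
Proof.
case: A => [A /andP[uA /eqP fA]] /=; rewrite /isGLfix unitmx_inv uA /=.
apply/eqP; rewrite -[in RHS]fA.
by elim: (2 ^ e)%N => //= d ->; rewrite FrobV.
Qed.

Definition GLfix_mul e N (A B : GLfix e N) : GLfix e N :=
  MkGLfix (GLfix_mul_subproof A B).
Definition GLfix_one e N : GLfix e N := MkGLfix (GLfix_one_subproof e N).
Definition GLfix_inv e N (A : GLfix e N) : GLfix e N :=
  MkGLfix (GLfix_inv_subproof A).

Fact GLfix_mulA e N : associative (@GLfix_mul e N).
Proof. by move=> A B C; apply: val_inj; rewrite /= mulmxA. Qed.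
Fact GLfix_mul1 e N : left_id (GLfix_one e N) (@GLfix_mul e N).
Proof. by move=> A; apply: val_inj; rewrite /= mul1mx. Qed.
Fact GLfix_mulV e N : left_inverse (GLfix_one e N) (@GLfix_inv e N) (@GLfix_mul e N).
Proof. by move=> A; apply: val_inj; rewrite /= mulVmx //; case/andP: (valP A). Qed.

(* Entries of a fixed point of F^(2^e) are roots of X^(q^(2^(e+1))) - X. *)
Definition GLfix_roots (e : nat) : seq K :=
  sval (closed_field_poly_normal ('X^(#|Fq| ^ (2 ^ e.+1)) - 'X : {poly K})).

Fact GLfix_entryP e N (A : GLfix e N) i j : A i j \in GLfix_roots e.
Proof.
rewrite /GLfix_roots; case: closed_field_poly_normal => r /= Dr.
set M := (#|Fq| ^ _)%N in Dr.
have M_gt1 : (1 < M)%N.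
  have := @ltn_exp2r 1 #|Fq| (2 ^ e.+1); rewrite exp1n expn_gt0 => -> //.
  exact: finNzRing_gt1.
have nz : 'X^M - 'X != 0 :> {poly K}.
  rewrite -size_poly_eq0 size_polyDl ?size_polyXn //.
  by rewrite size_polyN size_polyX ltnS.
have: root ('X^M - 'X) (A i j).
  rewrite /root !hornerE subr_eq0.
  have /andP[uA /eqP fA] := valP A.
  have it d : iter d.*2 (@Frob N) A = map_mx (fun x => x ^+ (#|Fq| ^ d.*2)) A.
    elim: d => [|d IH]; first by apply/matrixP=> k l; rewrite !mxE expr1.
    rewrite doubleS 2!iterS IH Frob2; apply/matrixP=> k l; rewrite !mxE /frobq.
    by rewrite -!exprM !expnSr mulnA.
  have : iter (2 ^ e).*2 (@Frob N) A = A by rewrite -addnn iterD !fA.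
  by rewrite it -mul2n -expnS => /matrixP/(_ i j); rewrite mxE => ->.
by rewrite Dr rootZ ?lead_coef_eq0 // root_prod_XsubC.
Qed.

Definition GLfix_code e N (A : GLfix e N) : 'M[seq_sub (GLfix_roots e)]_N :=
  \matrix_(i, j) SeqSub (GLfix_entryP A i j).
Definition GLfix_decode e N (B : 'M[seq_sub (GLfix_roots e)]_N) : option (GLfix e N) :=
  insub (map_mx (@ssval _ _) B).
Fact GLfix_codeK e N : pcancel (@GLfix_code e N) (@GLfix_decode e N).
Proof.
move=> A; rewrite /GLfix_decode.
rewrite (_ : map_mx _ _ = val A) ?valK //.
by apply/matrixP=> i j; rewrite !mxE.
Qed.

HB.instance Definition _ e N := PCanIsCountable (@GLfix_codeK e N).
HB.instance Definition _ e N : isFinite (GLfix e N) := PCanIsFinite (@GLfix_codeK e N).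
HB.instance Definition _ e N :=
  Finite_isGroup.Build (GLfix e N) (@GLfix_mulA e N) (@GLfix_mul1 e N) (@GLfix_mulV e N).

(* GL_N(q) and SL_N(q) if eta = 1, GU_N(q) and SU_N(q) if eta = -1. *)
Definition GL (N : nat) : {set GLfix 0 N} := [set: GLfix 0 N].
Definition SL (N : nat) : {set GLfix 0 N} := [set A : GLfix 0 N | \det (val A) == 1].

End FixedPoints.

Section SymplecticType.

Variables (Fq : finFieldType) (K : closedFieldType) (FtoK : {rmorphism Fq -> K}).
Variable eta : int.
(* Intended: zeta alpha has order 2^(a + alpha) with 2^a = (q + eta)_2, zeta4 has
   order 4, \det (g alpha) = 1 and (g alpha)^-1 F(g alpha) = wmx (2 ^ alpha), all
   for alpha > 0; the theorem assumes this. *)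
Variables (zeta : nat -> K) (zeta4 : K) (g : forall alpha : nat, 'M[K]_(2 ^ alpha)).

Local Notation "A (x) B" := (otimes A B) (at level 40, left associativity).
Local Notation GLfix := (GLfix FtoK eta).
Local Notation Frob := (Frob FtoK eta).

(* (0 -1; I_(k-1) 0) *)
Definition wmx (k : nat) : 'M[K]_k :=
  \matrix_(i, j) if i == j.+1 :> nat then 1
                 else if (i == 0 :> nat) && (j.+1 == k) then -1 else 0.

Definition xmx : 'M[K]_2 := \matrix_(i, j) if i == j then (-1) ^+ i else 0.
Definition ymx : 'M[K]_2 := \matrix_(i, j) (i != j)%:R.
(* (0 1; -1 0) *)
Definition vmx : 'M[K]_2 := - wmx 2.
Definition zmx : 'M[K]_2 :=
  \matrix_(i, j) if i == j then (if i == 0 then zeta4 else zeta4^-1) else 0.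

(* B 0 (x) ... (x) B (gamma - 1) *)
Fixpoint tens (B : nat -> 'M[K]_2) (gamma : nat) : 'M[K]_(2 ^ gamma) :=
  if gamma is gamma'.+1
  then castsq (esym (expnSr 2 gamma')) (tens B gamma' (x) B gamma')
  else 1%:M.

(* Positions are numbered from 0: attens gamma c j is x_(j+1) for c = xmx and
   y_(j+1) for c = ymx. *)
Definition attens (gamma : nat) (c : 'M[K]_2) (j : nat) : 'M[K]_(2 ^ gamma) :=
  tens (fun i => if i == j then c else 1%:M) gamma.

(* The I_m (x) x_j and I_m (x) y_j with 1 <= j <= n, inside degree m 2^gamma. *)
Definition xygens (m gamma n : nat) : seq 'M[K]_(m * 2 ^ gamma) :=
  [seq (1%:M : 'M[K]_m) (x) attens gamma xmx j | j <- iota 0 n] ++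
  [seq (1%:M : 'M[K]_m) (x) attens gamma ymx j | j <- iota 0 n].

(* Only the members of s that are fixed by F^(2^e) count; under the assumptions
   above this is the case of all the generators used below. *)
Definition subgen (e N : nat) (s : seq 'M[K]_N) : {set GLfix e N} :=
  <<[set A : GLfix e N | val A \in s]>>%g.

Definition R0 (m alpha gamma : nat) : {set GLfix alpha (m * 2 ^ gamma)} :=
  subgen alpha ((zeta alpha)%:M :: xygens m gamma gamma).

(* diag(A, F(A), ..., F^(k-1)(A)); the outer (block) index is the second tensor
   factor. *)
Definition Fdiag (n k : nat) (A : 'M[K]_n) : 'M[K]_(n * k) :=
  \sum_(i < k) iter i (@Frob n) A (x) delta_mx i i.

Fact deg_subproof m alpha gamma :
  (m * 2 ^ gamma * 2 ^ alpha = m * 2 ^ (alpha + gamma))%N.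
Proof. by rewrite -mulnA -expnD addnC. Qed.

Definition gconj (n alpha : nat) (A : 'M[K]_(n * 2 ^ alpha)) : 'M[K]_(n * 2 ^ alpha) :=
  let G := (1%:M : 'M[K]_n) (x) g alpha in G *m A *m invmx G.

(* R~_(m, alpha, gamma) for alpha > 0 *)
Definition Rpos (m alpha gamma : nat) : {set GLfix 0 (m * 2 ^ (alpha + gamma))} :=
  [set B : GLfix 0 (m * 2 ^ (alpha + gamma)) |
    [exists (A : GLfix alpha (m * 2 ^ gamma) | A \in R0 m alpha gamma),
      val B == castsq (deg_subproof m alpha gamma) (gconj (Fdiag (2 ^ alpha) (val A)))]].

(* I_(m 2^gamma) (x) g_1 c g_1^-1, in degree m 2^(gamma + 1) *)
Definition lastgen (m gamma : nat) (c : 'M[K]_2) : 'M[K]_(m * 2 ^ gamma.+1) :=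
  castsq (deg_subproof m 1 gamma)
    ((1%:M : 'M[K]_(m * 2 ^ gamma)) (x) ((g 1 : 'M[K]_2) *m c *m invmx (g 1 : 'M[K]_2))).

(* R~_(m, 0, gamma + 1) = S~_(m, 1, gamma) *)
Definition Smx (m gamma : nat) : {set GLfix 0 (m * 2 ^ gamma.+1)} :=
  <<Rpos m 1 gamma :|: [set A : GLfix 0 (m * 2 ^ gamma.+1) | val A == lastgen m gamma vmx]>>%g.

Definition Eplus (m gamma : nat) : {set GLfix 0 (m * 2 ^ gamma)} :=
  subgen 0 (xygens m gamma gamma).

Definition Eminus (m gamma : nat) : {set GLfix 0 (m * 2 ^ gamma)} :=
  if gamma is gamma'.+1 then
    subgen 0 ([:: lastgen m gamma' zmx; lastgen m gamma' vmx]
              ++ xygens m gamma'.+1 gamma')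
  else 1%g.

(* Std alpha gamma stands for R~_(m, alpha, gamma), and ExtPlus gamma and
   ExtMinus gamma for R~^+_(m, 0, gamma) and R~^-_(m, 0, gamma). *)
Inductive symptype :=
  | Std of nat & nat
  | ExtPlus of nat
  | ExtMinus of nat.

Definition alpha_of (t : symptype) : nat := if t is Std alpha _ then alpha else 0.
Definition gamma_of (t : symptype) : nat :=
  match t with Std _ gamma | ExtPlus gamma | ExtMinus gamma => gamma end.

Definition symptype_ok (t : symptype) : bool :=
  match t with
  | Std _ _ => true
  | ExtPlus gamma => (1 < gamma)%N
  | ExtMinus gamma => (0 < gamma)%N
  end.

Definition Rstd (m alpha gamma : nat) : {set GLfix 0 (m * 2 ^ (alpha + gamma))} :=
  match alpha return {set GLfix 0 (m * 2 ^ (alpha + gamma))} with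
  | alpha'.+1 => Rpos m alpha'.+1 gamma
  | 0 =>
    match gamma return {set GLfix 0 (m * 2 ^ (0 + gamma))} with
    | gamma'.+1 => Smx m gamma'
    | 0 => [set A : GLfix 0 (m * 2 ^ (0 + 0)) | (val A == 1%:M) || (val A == - 1%:M)]
    end
  end.

Definition symp (m : nat) (t : symptype) :
    {set GLfix 0 (m * 2 ^ (alpha_of t + gamma_of t))} :=
  match t with
  | Std alpha gamma => Rstd m alpha gamma
  | ExtPlus gamma => Eplus m gamma
  | ExtMinus gamma => Eminus m gamma
  end.

End SymplecticType.

Section Radical.

Variable gT : finGroupType.
Implicit Types R G H : {set gT}.

Definition radical2 R G : Prop :=
  [/\ R \subset G, 2.-group R & R = 'O_2('N_G(R))]%g.

Definition special2 R G H : Prop :=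
  radical2 R G /\ R = 'O_2('N_G(R :&: H))%g.

End Radical.

(* Main.v *)
Require Import Defs.
From mathcomp Require Import all_boot all_order all_algebra all_fingroup all_solvable all_field.
From mathcomp Require Import mxtens zify.

(** Write G for GL_N(eta q) and S for the intersection of R with SL_N(eta q).
    Every element that normalizes R normalizes S. Therefore a radical R is special if
    and only if the normalizer of S normalizes R ([special2_norm] and
    [special2_norm_sub]). This is clear if S = R, so determinants come first.

    The extraspecial types lie in SL, as do the images of the x_j and y_j and the
    matrix (0 1; -1 0) in all types ([det_attens], [Eplus_sub_SL],
    [Eminus_sub_SL], [Smx_sub_SL]). The only generator that can fail to is the image
    z of the scalar zeta. Its determinant is the product of the F^i(zeta) for
    i < 2^alpha, which is -1 ([prod_iter_sfrob]), raised to the power m 2^gamma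
    ([Rpos_sub_SL]). Hence S = R unless that exponent is odd. What remains besides
    the scalars {1, -1}, which all of G normalizes, are three families with m odd, in
    which S has index 2 in R and contains z^2 but not z.

    - R = <z> with alpha = 1. Since zeta F(zeta) = -1, the element z satisfies
      z - z^-1 = t for a nonzero scalar t, so t z = z^2 - 1. A conjugate of z whose
      square is a power of z then is a power of z up to sign ([quadratic_root_pow],
      [conj_sqr_mem_cycle]), so the normalizer of S normalizes R.

    - R = <z> with alpha >= 2. Now F^(2^(alpha-1)) negates zeta, so a power x of the
      conjugated shift g w g^-1 satisfies x^2 = -1 and x z = - z x. It commutes with
      z^2, and from it and a power y of z with y^2 = -1 one obtains an element
      (1 + x)(1 + y)/2 of G that centralizes S but moves z to - x z, outside R
      ([Frob_half_product], [not_norm_meet_cyclic]).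

    - R = <z, v> semidihedral of order 2^(a+2), where v is the image of
      (0 1; -1 0), and S = <z^2, v> is generalized quaternion. If a >= 3, then
      conjugates of z^2 in S lie in <z> because of their order, and the argument of
      the first family applies ([norm_meet_semidihedral]). If a = 2, then S is
      quaternion of order 8, with i = z^2 and j = v, and the Hurwitz unit
      (1 + i)(1 + j)/2 is an element of G that normalizes S and not R
      ([quaternion_rotate], [not_norm_meet_semidihedral]).

    For eta = -1 the map F is not additive, so membership of these half sums in G is
    not automatic; [Frob_half_product] proves it for both signs at once. *)

Set Implicit Arguments.
Unset Strict Implicit.
Unset Printing Implicit Defensive.

Import GRing.Theory.
Local Open Scope ring_scope.

(** * Tensor products and their determinants *)

Section CastSquare.
Variables (R : comUnitRingType) (n n' : nat) (e : n = n').
Implicit Types A B : 'M[R]_n.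

Lemma castsqM A B : castsq e (A *m B) = castsq e A *m castsq e B.
Proof. by rewrite /castsq; case: _ / e; rewrite !castmx_id. Qed.

Lemma castsq_scalar (c : R) : castsq e c%:M = c%:M.
Proof. by rewrite /castsq; case: _ / e; rewrite !castmx_id. Qed.

Lemma castsq_tr A : castsq e A^T = (castsq e A)^T.
Proof. by rewrite /castsq; case: _ / e; rewrite !castmx_id. Qed.

Lemma castsqZ (c : R) A : castsq e (c *: A) = c *: castsq e A.
Proof. by rewrite /castsq; case: _ / e; rewrite !castmx_id. Qed.

Lemma castsqD A B : castsq e (A + B) = castsq e A + castsq e B.
Proof. by rewrite /castsq; case: _ / e; rewrite !castmx_id. Qed.

Lemma castsq_unit A : (castsq e A \in unitmx) = (A \in unitmx).
Proof. by rewrite /castsq; case: _ / e; rewrite !castmx_id. Qed.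

Lemma det_castsq A : \det (castsq e A) = \det A.
Proof. by rewrite /castsq; case: _ / e; rewrite !castmx_id. Qed.

Lemma map_castsq (f : {rmorphism R -> R}) A :
  map_mx f (castsq e A) = castsq e (map_mx f A).
Proof. by rewrite /castsq; case: _ / e; rewrite !castmx_id. Qed.

End CastSquare.

Section TensorDeterminant.
Variable R : comUnitRingType.

Lemma tens1_1 m n : (1%:M : 'M[R]_m) *t (1%:M : 'M[R]_n) = 1%:M.
Proof.
apply/matrixP=> i j; case: (mxtens_indexP i) => i0 i1.
case: (mxtens_indexP j) => j0 j1; rewrite tensmxE !mxE -natrM mulnb.
by rewrite (can_eq (@mxtens_indexK m n)) xpair_eqE.
Qed.

(** Peeling off the first row and column of the identity leaves a block diagonal
    matrix with blocks [A]. *)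
Lemma det_tens1l m n (A : 'M[R]_n) : \det ((1%:M : 'M[R]_m) *t A) = \det A ^+ m.
Proof.
elim: m => [|m IHm]; first by rewrite det_mx00.
rewrite (_ : 1%:M = block_mx 1%:M 0 0 1%:M :> 'M_(1 + m)); last first.
  by rewrite -scalar_mx_block.
rewrite tens_block_mx !tens0mx.
transitivity (\det (block_mx ((1%:M : 'M[R]_1) *t A) 0 0 ((1%:M : 'M[R]_m) *t A))).
  by rewrite -[in RHS](det_castsq (esym (mulnDl 1 m n))).
rewrite det_ublock IHm exprS; congr (_ * _).
by rewrite tens_scalar_mx scale1r; apply: (det_castsq (esym (mul1n n))).
Qed.

(** Swapping the two tensor indices is a permutation of the basis, applied to rows
    and columns alike, so it does not change the determinant. *)
Lemma det_tens1r m n (A : 'M[R]_m) : \det (A *t (1%:M : 'M[R]_n)) = \det A ^+ n.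
Proof.
(* The swap of the two tensor indices. *)
pose h (k : 'I_(m * n)) : 'I_(m * n) :=
  cast_ord (mulnC n m) (mxtens_index ((mxtens_unindex k).2, (mxtens_unindex k).1)).
have h_inj : injective h.
  move=> k l /cast_ord_inj /(can_inj (@mxtens_indexK _ _)) [e2 e1].
  apply: (can_inj (@mxtens_unindexK m n)).
  by apply/pair_eqP; rewrite /= -val_eqE /= e1 -val_eqE /= e2 !eqxx.
pose s := perm h_inj.
have -> : A *t (1%:M : 'M[R]_n) =
    row_perm s (col_perm s (castsq (mulnC n m) ((1%:M : 'M[R]_n) *t A))).
  apply/matrixP=> i j; rewrite !mxE !permE /h castmxE !cast_ordK !tensmxE mulrC.
  by rewrite !mxE.
rewrite row_permE col_permE !det_mulmx det_castsq det_tens1l !det_perm odd_permV.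
by rewrite mulrC -mulrA -expr2 sqrr_sign mulr1.
Qed.

End TensorDeterminant.

Section Otimes.
Variables (R : comUnitRingType) (m n : nat).
Implicit Types (A C : 'M[R]_m) (B D : 'M[R]_n).

Lemma otimesM A B C D :
  otimes A B *m otimes C D = otimes (A *m C) (B *m D).
Proof. by rewrite /otimes -castsqM tensmx_mul. Qed.

Lemma otimes1 : otimes (1%:M : 'M[R]_m) (1%:M : 'M[R]_n) = 1%:M.
Proof. by rewrite /otimes tens1_1 castsq_scalar. Qed.

Lemma otimes_unit A B : A \in unitmx -> B \in unitmx -> otimes A B \in unitmx.
Proof.
move=> uA uB; have : otimes A B *m otimes (invmx A) (invmx B) = 1%:M.
  by rewrite otimesM !mulmxV ?otimes1.
by case/mulmx1_unit.
Qed.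

Lemma otimesV A B : A \in unitmx -> B \in unitmx ->
  invmx (otimes A B) = otimes (invmx A) (invmx B).
Proof.
move=> uA uB; apply: (can_inj (mulKmx (otimes_unit uA uB))).
by rewrite mulmxV ?otimes_unit // otimesM !mulmxV ?otimes1.
Qed.

Lemma otimes_tr A B : (otimes A B)^T = otimes A^T B^T.
Proof. by rewrite /otimes -castsq_tr trmx_tens. Qed.

Lemma map_otimes (f : {rmorphism R -> R}) A B :
  map_mx f (otimes A B) = otimes (map_mx f A) (map_mx f B).
Proof. by rewrite /otimes map_castsq map_mxT. Qed.

Lemma det_otimes A B : \det (otimes A B) = \det A ^+ n * \det B ^+ m.
Proof.
rewrite -[A in otimes A B]mulmx1 -[B in otimes _ B]mul1mx -otimesM det_mulmx.
by rewrite /otimes !det_castsq det_tens1l det_tens1r.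
Qed.

Lemma otimesDr A B D : otimes A (B + D) = otimes A B + otimes A D.
Proof.
rewrite /otimes -castsqD; congr castsq.
by apply/matrixP=> i j; rewrite !mxE mulrDl.
Qed.

Lemma otimesZr (c : R) A B : otimes A (c *: B) = c *: otimes A B.
Proof. by apply/matrixP=> i j; rewrite mxE !castmxE !mxE mulrA. Qed.

Lemma otimes_sumr I (r : seq I) P A (F : I -> 'M[R]_n) :
  otimes A (\sum_(i <- r | P i) F i) = \sum_(i <- r | P i) otimes A (F i).
Proof.
have otimes0 : otimes A (0 : 'M_n) = 0.
  by apply/matrixP=> i j; rewrite castmxE !mxE mul0r.
exact: (big_morph _ (otimesDr A) otimes0).
Qed.

Lemma otimes_scalarl (c : R) B :
  otimes (c%:M : 'M[R]_m) B = otimes 1%:M (c *: B).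
Proof.
rewrite /otimes; congr castsq; apply/matrixP=> i j; rewrite !mxE.
by rewrite -mulr_natr mulrA [c * _]mulrC.
Qed.

End Otimes.

(** * The Frobenius map F on structured matrices *)

Section Frobenius.
Variables (Fq : finFieldType) (K : closedFieldType) (FtoK : {rmorphism Fq -> K}).
Variable eta : int.
Local Notation Frob := (Frob FtoK eta).
Local Notation frob := (frobq FtoK).

(** The action of F on GL_1, that is, [s |-> s ^ (eta * q)]. *)
Definition sfrob (s : K) : K := if eta == 1 then frob s else (frob s)^-1.

Lemma sfrobM s t : sfrob (s * t) = sfrob s * sfrob t.
Proof. by rewrite /sfrob; case: ifP => _; rewrite rmorphM //= invfM. Qed.

Lemma sfrob1 : sfrob 1 = 1.
Proof. by rewrite /sfrob rmorph1 invr1; case: ifP. Qed.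

Lemma sfrobN s : sfrob (- s) = - sfrob s.
Proof. by rewrite /sfrob; case: ifP => _; rewrite rmorphN //= invrN. Qed.

Lemma sfrobV s : sfrob s^-1 = (sfrob s)^-1.
Proof. by rewrite /sfrob; case: ifP => _; rewrite fmorphV. Qed.

Lemma sfrob_eq0 s : (sfrob s == 0) = (s == 0).
Proof. by rewrite /sfrob; case: ifP => _; rewrite ?invr_eq0 fmorph_eq0. Qed.

Lemma iter_sfrobM i s t : iter i sfrob (s * t) = iter i sfrob s * iter i sfrob t.
Proof. by elim: i => //= i ->; rewrite sfrobM. Qed.

Lemma iter_sfrobN i s : iter i sfrob (- s) = - iter i sfrob s.
Proof. by elim: i => //= i ->; rewrite sfrobN. Qed.

Lemma iter_sfrob1 i : iter i sfrob 1 = 1.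
Proof. by elim: i => //= i ->; rewrite sfrob1. Qed.

Lemma iter_sfrob_eq0 i s : (iter i sfrob s == 0) = (s == 0).
Proof. by elim: i => //= i <-; rewrite sfrob_eq0. Qed.

Lemma Frob_scalar n (s : K) : Frob (s%:M : 'M_n) = (sfrob s)%:M.
Proof.
by rewrite /Defs.Frob /sfrob map_scalar_mx invmx_scalar tr_scalar_mx; case: ifP.
Qed.

Lemma iter_Frob_scalar n i (s : K) :
  iter i (@Defs.Frob _ _ FtoK eta n) s%:M = (iter i sfrob s)%:M.
Proof. by elim: i => //= i ->; rewrite Frob_scalar. Qed.

Lemma Frob_castsq n n' (e : n = n') (A : 'M[K]_n) :
  Frob (castsq e A) = castsq e (Frob A).
Proof. by rewrite /castsq; case: _ / e; rewrite !castmx_id. Qed.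

Lemma Frob_otimes m n (A : 'M[K]_m) (B : 'M[K]_n) :
  A \in unitmx -> B \in unitmx -> Frob (otimes A B) = otimes (Frob A) (Frob B).
Proof.
move=> uA uB; rewrite /Defs.Frob map_otimes; case: ifP => // _.
by rewrite otimesV ?map_unitmx // otimes_tr.
Qed.

Lemma Frob_diag n (d : 'rV[K]_n) : (forall i, d 0 i != 0) ->
  Frob (diag_mx d) = diag_mx (map_mx sfrob d).
Proof.
move=> d_neq0; rewrite /Defs.Frob map_diag_mx /sfrob; case: ifP => _ //.
rewrite -[RHS]tr_diag_mx; congr trmx.
set D := diag_mx _; set E := diag_mx _.
have DE : D *m E = 1%:M.
  rewrite mulmx_diag -diag_const_mx; congr diag_mx; apply/rowP=> i.
  by rewrite !mxE mulfV // fmorph_eq0.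
have uD : D \in unitmx by case/mulmx1_unit: DE.
by rewrite -[LHS]mulmx1 -DE mulKmx.
Qed.

(** An orthogonal matrix is its own inverse transpose, so the two forms of F agree
    on it. *)
Lemma Frob_orthogonal n (A : 'M[K]_n) :
  map_mx frob A = A -> A *m A^T = 1%:M -> Frob A = A.
Proof.
move=> fA oA; rewrite /Defs.Frob fA; case: ifP => // _.
have [uA _] := mulmx1_unit oA.
by rewrite -[invmx A]mulmx1 -oA mulKmx ?trmxK.
Qed.

Lemma isGLfix_fixed e n (A : 'M[K]_n) :
  A \in unitmx -> Frob A = A -> isGLfix FtoK eta e A.
Proof.
by move=> uA fA; rewrite /isGLfix uA /=; elim: (2 ^ e)%N => //= d /eqP ->; apply/eqP.
Qed.

Lemma Frob_GLfix n (A : GLfix FtoK eta 0 n) : Frob (val A) = val A.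
Proof. by case/andP: (valP A) => _ /eqP. Qed.

Lemma GLfix_unit e n (A : GLfix FtoK eta e n) : val A \in unitmx.
Proof. by case/andP: (valP A). Qed.

(** For [eta = -1] the map F is not additive, so that sums of fixed points are
    rarely fixed. This one is: the inverse of [C] is half of [(1 - Y) (1 - X)], and
    since [- X] and [- Y] are the inverses of [X] and [Y], it is also the transpose
    of the entrywise q-th power of [C]. *)
Lemma Frob_half_product n (X Y : 'M[K]_n) : 2%:R != 0 :> K ->
    X *m X = - 1%:M -> Y *m Y = - 1%:M -> Frob X = X -> Frob Y = Y ->
  let C := (2%:R^-1 : K) *: ((1%:M + X) *m (1%:M + Y)) in
  (C \in unitmx) /\ Frob C = C.
Proof.
move=> nz2 XX YY fX fY C.
pose D := (2%:R^-1 : K) *: ((1%:M - Y) *m (1%:M - X)).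
have half (Z : 'M[K]_n) : Z *m Z = - 1%:M -> (1%:M + Z) *m (1%:M - Z) = (2%:R)%:M.
  move=> ZZ; rewrite mulmxDl mul1mx mulmxBr mulmx1 ZZ opprK addrA subrK.
  by rewrite (raddfD (@scalar_mx K n) 1 1).
have CD : C *m D = 1%:M.
  rewrite /C /D -scalemxAl -scalemxAr mulmxA -(mulmxA (1%:M + X)) half //.
  rewrite mul_mx_scalar -scalemxAl half //.
  by rewrite (scalerA _ 2%:R) mulVf // scale1r scale_scalar_mx mulVf.
have [uC _] := mulmx1_unit CD.
have fh : frob (2%:R^-1) = 2%:R^-1 by rewrite fmorphV rmorph_nat.
split=> //; rewrite /Defs.Frob.
have uX : X \in unitmx.
  by have /mulmx1_unit[] : X *m (- X) = 1%:M by rewrite mulmxN XX opprK.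
have uY : Y \in unitmx.
  by have /mulmx1_unit[] : Y *m (- Y) = 1%:M by rewrite mulmxN YY opprK.
have inv (Z : 'M[K]_n) : Z *m Z = - 1%:M -> Z \in unitmx -> invmx Z = - Z.
  by move=> ZZ uZ; rewrite -[invmx Z]mulmx1 -[1%:M]opprK -ZZ mulmxN mulKmx.
move: fX fY; rewrite /Defs.Frob; case: ifP => _ fX fY.
  by rewrite map_mxZ map_mxM !map_mxD map_mx1 fX fY /= fh.
have tr (Z : 'M[K]_n) : Z *m Z = - 1%:M -> Z \in unitmx ->
    (invmx (map_mx frob Z))^T = Z -> (map_mx frob Z)^T = - Z.
  move=> ZZ uZ fZ; rewrite -inv // -[in RHS]fZ -trmx_inv; congr trmx.
  by rewrite invmxK.
rewrite trmx_inv map_mxZ map_mxM !map_mxD map_mx1 /= fh.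
rewrite (_ : (_ *: _)^T = D); last first.
  rewrite linearZ /= trmx_mul; congr (_ *: (_ *m _)).
    by rewrite linearD /= trmx1 tr.
  by rewrite linearD /= trmx1 tr.
have [_ uD] := mulmx1_unit CD.
by rewrite -[invmx D]mul1mx -CD mulmxK.
Qed.

End Frobenius.

(** * The signed cyclic shift w and the twisted torus *)

Section SignedShift.
Variables (K : closedFieldType) (k : nat).
Implicit Types M : 'M[K]_k.

Lemma val_ord_pred (i : 'I_k) : (0 < i)%N -> val (ord_pred i) = i.-1.
Proof.
move=> i_gt0; rewrite /= -{1}(prednK i_gt0) addSn /= modnDr modn_small //.
exact: leq_ltn_trans (leq_pred i) (ltn_ord i).
Qed.

Lemma wmx_mulE M (i l : 'I_k) :
  (wmx K k *m M) i l = if i == 0%N :> nat then - M (rev_ord i) l else M (ord_pred i) l.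
Proof.
have k_gt0 : (0 < k)%N by apply: leq_ltn_trans (ltn_ord i).
case: ifPn => [/eqP i0|i_neq0]; rewrite mxE.
  have Ek n : (n.+1 == k) = (n == k.-1) by rewrite -{1}(prednK k_gt0) eqSS.
  have rev0 : rev_ord i = k.-1 :> nat by rewrite /= i0 subn1.
  rewrite (bigD1 (rev_ord i)) //= mxE rev0 prednK // i0 !eqxx (ltn_eqF k_gt0) /= mulN1r.
  rewrite big1 ?addr0 // => j; rewrite -val_eqE /= i0 subn1 => j_neq.
  by rewrite mxE i0 Ek (negPf j_neq) mul0r.
have i_gt0 : (0 < i)%N by rewrite lt0n.
have predi := val_ord_pred i_gt0.
rewrite (bigD1 (ord_pred i)) //= mxE [nat_of_ord (ord_pred i)]predi prednK // eqxx mul1r.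
rewrite big1 ?addr0 // => j; rewrite -val_eqE predi => j_neq.
rewrite mxE (negPf i_neq0) -{1}(prednK i_gt0) eqSS eq_sym (negPf j_neq).
by rewrite mul0r.
Qed.

(** A shift by [j] picks up a sign exactly where it wraps around. *)
Lemma wmx_pow j : (j <= k)%N ->
  (wmx K k) ^+ j =
    \matrix_(i < k, l < k) ((i == l + j :> nat)%N%:R - (i + k == l + j :> nat)%N%:R).
Proof.
elim: j => [|j IHj] lejk.
  apply/matrixP=> i l; rewrite !mxE !addn0 (_ : (i + k == l)%N = false) ?subr0 //.
  by apply/negP=> /eqP e; have := ltn_ord l; rewrite -e ltnNge leq_addl.
rewrite exprS (IHj (ltnW lejk)); apply/matrixP=> i l.
have k_gt0 : (0 < k)%N by apply: leq_ltn_trans (ltn_ord i).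
have [li ll] := (ltn_ord i, ltn_ord l).
rewrite [LHS]wmx_mulE; case: ifPn => [/eqP i0|i_neq0]; rewrite !mxE /= !addnS.
  have Ek n : (k == n.+1) = (k.-1 == n) by rewrite -{1}(prednK k_gt0) eqSS.
  rewrite i0 subn1 add0n Ek (ltn_eqF (ltn0Sn _)) sub0r.
  rewrite (_ : (k.-1 + k == l + j)%N = false) ?subr0 //; apply: gtn_eqF.
  have := leq_add ll lejk; have -> : (k + k = (k.-1 + k).+1)%N by rewrite -addSn prednK.
  by rewrite addSn addnS ltnS.
have i_gt0 : (0 < i)%N by rewrite lt0n.
rewrite -[((i + k).-1 %% k)%N]/(val (ord_pred i)) val_ord_pred //.
by rewrite -{3 4}(prednK i_gt0) addSn !eqSS.
Qed.

Lemma wmx_order : (wmx K k) ^+ k = - 1%:M.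
Proof.
rewrite wmx_pow //; apply/matrixP=> i l; rewrite !mxE eqn_add2r.
rewrite (_ : (i == l + k :> nat)%N = false) ?sub0r //.
by apply/negP=> /eqP e; have := ltn_ord i; rewrite e ltnNge leq_addl.
Qed.

Lemma wmx_orthogonal : wmx K k *m (wmx K k)^T = 1%:M.
Proof.
apply/matrixP=> i l; have [li ll] := (ltn_ord i, ltn_ord l).
have k_gt0 : (0 < k)%N by apply: leq_ltn_trans (ltn_ord i).
rewrite wmx_mulE !mxE; case: ifPn => [/eqP i0|i_neq0].
  rewrite /= i0 subn1 prednK // eqxx andbT (_ : (l == k :> nat) = false); last first.
    by apply/negP=> /eqP e; rewrite e ltnn in ll.
  by rewrite -val_eqE /= i0 [0%N == _]eq_sym; case: ifP => _; rewrite ?opprK ?oppr0.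
have i_gt0 : (0 < i)%N by rewrite lt0n.
have predi : nat_of_ord (ord_pred i) = i.-1 := val_ord_pred i_gt0.
rewrite predi prednK // -val_eqE eq_sym /=.
case: ifP => // neq_il.
rewrite (_ : (i == k :> nat) = false) ?andbF //.
by apply/negP=> /eqP e; rewrite e ltnn in li.
Qed.

End SignedShift.

Section FrobeniusTorus.
Variables (Fq : finFieldType) (K : closedFieldType) (FtoK : {rmorphism Fq -> K}).
Variable eta : int.
Variables (k : nat) (g : 'M[K]_k).
Local Notation Frob := (Frob FtoK eta).
Local Notation phi := (sfrob FtoK eta).
Local Notation w := (wmx K k).
Hypotheses (ug : g \in unitmx) (gF : invmx g *m Frob g = w).
Implicit Types (s t : K) (A B : 'M[K]_k).

Definition conjg_mx A : 'M[K]_k := g *m A *m invmx g.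

Lemma conjg_mxM A B : conjg_mx (A *m B) = conjg_mx A *m conjg_mx B.
Proof. by rewrite /conjg_mx !mulmxA mulmxKV. Qed.

Lemma conjg_mx_scalar s : conjg_mx s%:M = s%:M.
Proof. by rewrite /conjg_mx mul_mx_scalar -scalemxAl mulmxV // scalemx1. Qed.

Lemma conjg_mxX A n : conjg_mx (A ^+ n) = conjg_mx A ^+ n.
Proof.
elim: n => [|n IHn]; first exact: (conjg_mx_scalar 1).
by rewrite !exprS [LHS]conjg_mxM IHn.
Qed.

Lemma conjg_mxD A B : conjg_mx (A + B) = conjg_mx A + conjg_mx B.
Proof. by rewrite /conjg_mx mulmxDr mulmxDl. Qed.

Lemma det_conjg_mx A : \det (conjg_mx A) = \det A.
Proof.
by rewrite /conjg_mx !det_mulmx mulrAC -det_mulmx mulmxV // det1 mul1r.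
Qed.

Lemma conjg_mx_unit A : (conjg_mx A \in unitmx) = (A \in unitmx).
Proof. by rewrite !unitmxE det_conjg_mx. Qed.

Lemma wmx_unit : w \in unitmx.
Proof. by case/mulmx1_unit: (wmx_orthogonal K k). Qed.

Lemma Frob_wmx : Frob w = w.
Proof.
apply: Frob_orthogonal (wmx_orthogonal K k); apply/matrixP=> i j; rewrite !mxE.
by case: ifP => _; [|case: ifP => _]; rewrite ?rmorphN ?rmorph1 ?rmorph0.
Qed.

(** As F(g) = g w, conjugation by [g] carries F over to F followed by conjugation
    by [w]. *)
Lemma Frob_conjg_mx A B : A \in unitmx -> w *m Frob A = B *m w ->
  Frob (conjg_mx A) = conjg_mx B.
Proof.
move=> uA wA; have Fg : Frob g = g *m w by rewrite -gF mulKVmx.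
rewrite /conjg_mx !FrobM ?unitmx_mul ?unitmx_inv ?ug // FrobV Fg.
rewrite -(mulmxA g) wA -!mulmxA; congr (g *m (B *m _)).
have ugw : g *m w \in unitmx by rewrite unitmx_mul ug wmx_unit.
by apply: (can_inj (mulmxK ugw)); rewrite mulmxKV // mulKmx.
Qed.

(** After conjugation by [g], these matrices form the torus of rational points
    that is isomorphic to GL_1((eta q)^k). *)
Definition torus s : 'M[K]_k := diag_mx (\row_i iter i phi s).

Lemma torusM s t : torus (s * t) = torus s *m torus t.
Proof.
rewrite /torus mulmx_diag; congr diag_mx; apply/rowP=> i.
by rewrite !mxE iter_sfrobM.
Qed.

Lemma torus1 : torus 1 = 1%:M.
Proof.
rewrite -diag_const_mx; congr diag_mx; apply/rowP=> i.
by rewrite !mxE iter_sfrob1.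
Qed.

Lemma torusN s : torus (- s) = - torus s.
Proof.
rewrite /torus -linearN; congr diag_mx; apply/rowP=> i.
by rewrite !mxE iter_sfrobN.
Qed.

Lemma torusX s n : torus (s ^+ n) = torus s ^+ n.
Proof.
elim: n => [|n IHn]; first exact: torus1.
by rewrite !exprS torusM IHn.
Qed.

Lemma torus_unit s : s != 0 -> torus s \in unitmx.
Proof.
move=> nzs; have /mulmx1_unit[] : torus s *m torus s^-1 = 1%:M => //.
by rewrite -torusM mulfV // torus1.
Qed.

Lemma det_torus s : \det (torus s) = \prod_(i < k) iter i phi s.
Proof. by rewrite det_diag; apply: eq_bigr => i _; rewrite mxE. Qed.

(** Conjugation by [w] moves the diagonal by one step, which is one application of
    F; the period of [s] closes the cycle, and the sign in [w] cancels. *)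
Lemma wmx_torus s : iter k phi s = s -> w *m torus (phi s) = torus s *m w.
Proof.
move=> fk; apply/matrixP=> i j; rewrite mul_mx_diag mul_diag_mx !mxE.
case: ifP => [/eqP ->|_]; first by rewrite mul1r mulr1 -iterSr.
case: ifP => [/andP[/eqP-> /eqP jk]|]; last by rewrite mul0r mulr0.
by rewrite mulN1r mulrN1 -iterSr jk fk.
Qed.

Lemma Frob_torus s : s != 0 -> Frob (torus s) = torus (phi s).
Proof.
move=> nzs; rewrite Frob_diag => [|i]; last by rewrite !mxE iter_sfrob_eq0.
by congr diag_mx; apply/rowP=> i; rewrite !mxE -iterS iterSr.
Qed.

(** The twist by [w] undoes the step that F makes along the diagonal. *)
Lemma Frob_conjg_torus s : s != 0 -> iter k phi s = s ->
  Frob (conjg_mx (torus s)) = conjg_mx (torus s).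
Proof.
move=> nzs fk; apply: Frob_conjg_mx; first exact: torus_unit.
by rewrite Frob_torus // wmx_torus.
Qed.

Lemma Frob_conjg_wmx : Frob (conjg_mx w) = conjg_mx w.
Proof. by apply: Frob_conjg_mx; rewrite ?wmx_unit // Frob_wmx. Qed.

Lemma wmxX_torus s n : iter k phi s = s ->
  w ^+ n *m torus (iter n phi s) = torus s *m w ^+ n.
Proof.
move=> fk; elim: n => [|n IHn]; first by rewrite /= mul1mx mulmx1.
rewrite exprSr -[_ * _]/(_ *m _) iterS -mulmxA wmx_torus ?mulmxA ?IHn //.
by rewrite -iterD addnC iterD fk.
Qed.

End FrobeniusTorus.

(** * Roots of unity of 2-power order under F *)

Lemma logn2_double_odd n : odd n -> logn 2 (2 * n) = 1%N.
Proof.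
move=> n_odd; rewrite lognM ?(odd_gt0 n_odd) // (lognE 2 n) dvdn2 n_odd.
by rewrite !andbF.
Qed.

Lemma prim_expr_half (F : fieldType) n (z : F) :
  (2 ^ n.+1).-primitive_root z -> z ^+ (2 ^ n) = -1.
Proof.
move=> zP; have : (z ^+ (2 ^ n)) ^+ 2 == 1.
  by rewrite -exprM -expnSr (prim_expr_order zP).
rewrite sqrf_eq1 => /orP[|/eqP//]; rewrite -(prim_order_dvd zP).
by rewrite dvdn_Pexp2l // ltnn.
Qed.

(** [z ^+ l] is an odd power of [z ^+ (2 ^ n) = -1]. *)
Lemma prim_expr_N1 (F : fieldType) n (z : F) l :
  (2 ^ n.+1).-primitive_root z -> (0 < l)%N -> logn 2 l = n -> z ^+ l = -1.
Proof.
move=> zP l_gt0 l2; rewrite -(partnC 2%N l_gt0) p_part l2 exprM prim_expr_half //.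
by rewrite -signr_odd odd_2'nat part_pnat.
Qed.

Lemma prim_sqr (F : fieldType) n (z : F) :
  (2 ^ n.+1).-primitive_root z -> (2 ^ n).-primitive_root (z ^+ 2).
Proof.
move=> zP; have := exp_prim_root zP 2.
by rewrite expnS (gcdn_idPl (dvdn_mulr _ (dvdnn 2))) mulKn.
Qed.

Section RootArithmetic.
Variables (Fq : finFieldType) (K : closedFieldType) (FtoK : {rmorphism Fq -> K}).
Variable eta : int.
Hypotheses (eta_sign : eta = 1 \/ eta = -1) (dvd4 : (4 %| #|Fq|%:Z + eta)%Z).
Variable a : nat.
Hypothesis def_a : a = logn 2 (absz (#|Fq|%:Z + eta)).
Local Notation q := #|Fq|.
Local Notation phi := (sfrob FtoK eta).

Let q_gt1 : (1 < q)%N. Proof. exact: finNzRing_gt1. Qed.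

(** One of [q + 1] and [q - 1], called [l], is divisible by 4 and carries [2 ^ a];
    the other, called [r], is twice an odd number. The norm of [s] involves the same
    [l] for both signs of [eta]. *)
Lemma twist_parts : exists l r : nat,
  [/\ [/\ (0 < l)%N, (4 %| l)%N & a = logn 2 l], [/\ (0 < r)%N & logn 2 r = 1%N],
      (q ^ 2 - 1 = l * r)%N &
      forall s : K, s != 0 -> s * phi s = if eta == 1 then s ^+ l else (s ^+ l)^-1].
Proof.
have [Deta|Deta] := eta_sign; rewrite def_a; move: (dvd4); rewrite Deta.
  rewrite -PoszD dvdzE -[(absz 4 %| _)%N]/(4 %| q + 1)%N absz_nat => /dvdnP[u Du].
  exists (q + 1)%N, (q - 1)%N.
  have u_gt0 : (0 < u)%N by case: u Du => //; rewrite addn1.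
  have Dq : (q - 1 = 2 * (u.-1.*2.+1))%N.
    by rewrite -muln2; lia.
  split=> //.
  - by split=> //; [rewrite addn1 | rewrite Du dvdn_mull].
  - by rewrite Dq logn2_double_odd //= odd_double.
  - by rewrite -{2}(exp1n 2) subn_sqr mulnC.
  by move=> s nzs; rewrite /sfrob eqxx /frobq addn1 exprS.
rewrite subzn ?(ltnW q_gt1) // dvdzE -[(absz 4 %| _)%N]/(4 %| q - 1)%N absz_nat.
move=> /dvdnP[u Du].
exists (q - 1)%N, (q + 1)%N.
have Dq : (q + 1 = 2 * (u.*2.+1))%N.
  by rewrite -muln2; lia.
split=> //.
- by rewrite subn_gt0 Du dvdn_mull.
- by rewrite Dq logn2_double_odd //= odd_double.
- by rewrite -{2}(exp1n 2) subn_sqr.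
move=> s nzs; rewrite /sfrob /= /frobq -{1}(subnK (ltnW q_gt1)) addn1 exprS.
by rewrite invfM mulrA mulfV // mul1r.
Qed.

Lemma a_ge2 : (2 <= a)%N.
Proof.
have [l [r [[l_gt0 l4 ->] _ _ _]]] := twist_parts.
by rewrite -pfactor_dvdn.
Qed.

Let iter2E n s : iter (2 ^ n.+1) phi s = s ^+ (q ^ (2 ^ n.+1)).
Proof.
elim: n s => [|n IHn] s.
  by rewrite /= /sfrob /frobq; case: (eta == 1); rewrite ?exprVn ?invrK -exprM.
by rewrite expnS mul2n -addnn iterD !IHn -exprM -expnD addnn -mul2n -expnS.
Qed.

(** Each squaring of [Q = q ^ (2 ^ j.+1)] contributes the factor [Q + 1], which is
    2 modulo 4. *)
Lemma logn_qpow j : logn 2 (q ^ (2 ^ j.+1) - 1) = (a + j.+1)%N.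
Proof.
have [l [r [[l_gt0 l4 Da] [r_gt0 r2] qlr _]]] := twist_parts.
elim: j => [|j IHj]; first by rewrite qlr lognM // -Da r2.
have q_odd : odd q.
  have : (2 %| q ^ 2 - 1)%N by rewrite qlr dvdn_mulr // (dvdn_trans _ l4).
  by rewrite dvdn2 oddB ?expn_gt0 ?(ltnW q_gt1) // oddX /= addbT negbK.
set Q := (q ^ (2 ^ j.+1))%N.
have Q_gt1 : (1 < Q)%N by rewrite -[1%N](exp1n (2 ^ j.+1)) ltn_exp2r ?expn_gt0.
have -> : (q ^ (2 ^ j.+2) - 1 = (Q - 1) * (Q + 1))%N.
  by rewrite (expnSr 2 j.+1) expnM -/Q -{2}(exp1n 2) subn_sqr.
have : (4 %| Q - 1)%N.
  rewrite (@pfactor_dvdn 2 2) // ?subn_gt0 // IHj.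
  exact: leq_trans a_ge2 (leq_addr _ _).
case/dvdnP=> u Du; have DQ : (Q + 1 = 2 * (u.*2.+1))%N by rewrite -muln2; lia.
rewrite lognM ?subn_gt0 ?addn1 // IHj -[Q.+1]addn1 DQ logn2_double_odd /= ?odd_double //.
by rewrite addn1 [in RHS]addnS.
Qed.

Lemma mul_sfrob_root z : (2 ^ (a + 1)).-primitive_root z -> z * phi z = -1.
Proof.
move=> zP; have [l [r [[l_gt0 _ Da] _ _ fl]]] := twist_parts.
have nzz : z != 0 by rewrite (prim_root_eq0 zP) expn_eq0.
rewrite addn1 in zP; have zl := prim_expr_N1 zP l_gt0 (esym Da).
by rewrite fl // zl invrN1 if_same.
Qed.

(** The exponent [q ^ (2 ^ alpha.+1) - 1] has exactly one factor 2 less than the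
    order of [z]. *)
Lemma iter_sfrob_half alpha z : (2 ^ (a + alpha.+2)).-primitive_root z ->
  iter (2 ^ alpha.+1) phi z = - z.
Proof.
move=> zP; rewrite iter2E.
have Q_gt1 : (1 < q ^ (2 ^ alpha.+1))%N.
  by apply: leq_trans q_gt1 _; rewrite -{1}[q]expn1 leq_pexp2l ?expn_gt0 // ltnW.
rewrite -(subnK (ltnW Q_gt1)) addn1 exprS (@prim_expr_N1 _ (a + alpha.+1)) //.
- by rewrite mulrN1.
- by rewrite -addnS.
- by rewrite subn_gt0.
exact: logn_qpow.
Qed.

Lemma iter_sfrob_period alpha z : (0 < alpha)%N -> (2 ^ (a + alpha)).-primitive_root z ->
  iter (2 ^ alpha) phi z = z.
Proof.
case: alpha => [//|[|alpha]] _ zP; last first.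
  rewrite expnS mul2n -addnn iterD (iter_sfrob_half zP) iter_sfrobN.
  by rewrite (iter_sfrob_half zP) opprK.
have := mul_sfrob_root zP => zfz.
have nzz : z != 0 by rewrite (prim_root_eq0 zP) expn_eq0.
have fz : phi z = - z^-1 by rewrite -[LHS](mulKf nzz) zfz mulrN1.
by rewrite /= fz sfrobN sfrobV fz invrN invrK opprK.
Qed.

(** Halving the product by pairing [i] with [i + 2 ^ alpha.+1] turns each pair into
    minus a conjugate of [z ^+ 2]; the signs cancel, and [z ^+ 2] has the order
    required one level below. *)
Lemma prod_iter_sfrob alpha z : (0 < alpha)%N -> (2 ^ (a + alpha)).-primitive_root z ->
  \prod_(i < 2 ^ alpha) iter i phi z = -1.
Proof.
case: alpha => // alpha _; elim: alpha z => [|alpha IHalpha] z zP.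
  by rewrite !big_ord_recl big_ord0 /= mulr1 mul_sfrob_root.
rewrite expnS mul2n -addnn big_split_ord /= -big_split /=.
rewrite -[RHS](IHalpha (z ^+ 2)); last by rewrite addnS in zP; apply: prim_sqr.
transitivity (\prod_(i < 2 ^ alpha.+1) - iter i phi (z ^+ 2)).
  apply: eq_bigr => i _; rewrite addnC iterD (iter_sfrob_half zP) iter_sfrobN.
  by rewrite mulrN -iter_sfrobM.
by rewrite prodrN card_ord -signr_odd oddX /= mul1r.
Qed.

End RootArithmetic.

(** * Criteria for a radical subgroup to be special *)

Section SpecialCriteria.
Variables (gT : finGroupType) (R : {set gT}) (G H : {group gT}).
Local Open Scope group_scope.

Lemma special2_sub : radical2 R G -> R \subset H -> special2 R G H.
Proof. by move=> radR sRH; split=> //; rewrite (setIidPl sRH); case: radR. Qed.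

(** The normalizer of [R] always normalizes [R :&: H], so the hypothesis makes the
    two normalizers equal, and with them their 2-cores. *)
Lemma special2_norm : radical2 R G -> G \subset 'N(H) ->
  'N_G(R :&: H) \subset 'N(R) -> special2 R G H.
Proof.
move=> radR nHG sNN; split=> //; suff -> : 'N_G(R :&: H) = 'N_G(R) by case: radR.
apply/eqP; rewrite eqEsubset !subsetI !subsetIl sNN /=.
apply/subsetP=> x /setIP[Gx nRx]; have nHx := subsetP nHG x Gx.
by rewrite inE conjIg (normP nRx) (normP nHx).
Qed.

(** A special [R] is the 2-core of the normalizer of [R :&: H], hence normal in it. *)
Lemma special2_norm_sub : special2 R G H -> 'N_G(R :&: H) \subset 'N(R).
Proof. by case=> _ {2}->; apply: gFnorm. Qed.

End SpecialCriteria.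

(** * Subgroups of symplectic type inside the special linear group *)

Section Determinants.
Variables (Fq : finFieldType) (K : closedFieldType) (FtoK : {rmorphism Fq -> K}).
Variable eta : int.
Local Notation Frob := (Frob FtoK eta).
Local Notation frob := (frobq FtoK).
Local Notation GLfix := (GLfix FtoK eta).

Section Vals.
Variables e N : nat.
Implicit Types x y : GLfix e N.
Lemma GLfix_valM x y : val (x * y)%g = val x *m val y. Proof. by []. Qed.
Lemma GLfix_val1 : val (1%g : GLfix e N) = 1%:M. Proof. by []. Qed.
Lemma GLfix_valV x : val (x^-1)%g = invmx (val x). Proof. by []. Qed.
Lemma GLfix_valX x n : val (x ^+ n)%g = val x ^+ n.
Proof. by elim: n => // n IHn; rewrite expgS exprS GLfix_valM IHn. Qed.
Lemma GLfix_valJ x y : val (x ^ y)%g = invmx (val y) *m val x *m val y.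
Proof. by rewrite conjgE !GLfix_valM mulmxA. Qed.
End Vals.

Lemma SL_group_set N : group_set (SL FtoK eta N).
Proof.
apply/group_setP; split=> [|x y]; first by rewrite inE det1.
by rewrite !inE => /eqP dx /eqP dy; rewrite GLfix_valM det_mulmx dx dy mulr1.
Qed.
Canonical SL_group N := Group (@SL_group_set N).

Lemma GL_norm_SL N : (GL FtoK eta N \subset 'N(SL FtoK eta N))%g.
Proof.
apply/subsetP=> x _; rewrite inE; apply/subsetP=> _ /imsetP[y Sy ->].
rewrite !inE in Sy *; rewrite GLfix_valJ !det_mulmx mulrAC -det_mulmx.
by rewrite mulVmx ?GLfix_unit // det1 mul1r.
Qed.

(** The common features of the generators built from [xmx] and [ymx]: they survive
    tensor products, and they make a matrix fixed by F for both signs of [eta]. *)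
Definition rational_involution n (A : 'M[K]_n) :=
  [/\ map_mx frob A = A, A^T = A & A *m A = 1%:M].

Lemma rational_involution_Frob n (A : 'M[K]_n) : rational_involution A -> Frob A = A.
Proof. by case=> fA tA AA; apply: Frob_orthogonal; rewrite // tA. Qed.

Lemma rational_involution_det n (A : 'M[K]_n) : rational_involution A -> \det A ^+ 2 = 1.
Proof. by case=> _ _ AA; rewrite expr2 -det_mulmx AA det1. Qed.

Lemma rational_involution1 n : rational_involution (1%:M : 'M[K]_n).
Proof. by split; rewrite ?map_mx1 ?trmx1 ?mulmx1. Qed.

Lemma rational_involution_otimes m n (A : 'M[K]_m) (B : 'M[K]_n) :
  rational_involution A -> rational_involution B -> rational_involution (otimes A B).
Proof.
move=> [fA tA AA] [fB tB BB].
by split; rewrite ?map_otimes ?fA ?fB ?otimes_tr ?tA ?tB ?otimesM ?AA ?BB ?otimes1.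
Qed.

Lemma rational_involution_castsq n n' (e : n = n') (A : 'M[K]_n) :
  rational_involution A -> rational_involution (castsq e A).
Proof.
move=> [fA tA AA].
by split; rewrite ?map_castsq -?castsq_tr -?castsqM ?fA ?tA ?AA ?castsq_scalar.
Qed.

Lemma rational_involution_xmx : rational_involution (xmx K).
Proof.
split; apply/matrixP=> i j; rewrite !mxE.
- by case: ifP => _; rewrite ?rmorph0 ?rmorphXn ?rmorphN1.
- by rewrite eq_sym; case: eqP => // ->.
rewrite (bigD1 i) //= big1 ?addr0 => [|l neq_li]; rewrite !mxE; last first.
  by rewrite [i == l]eq_sym (negPf neq_li) mul0r.
by rewrite eqxx; case: ifP => _; rewrite ?mulr0 // -expr2 sqrr_sign.
Qed.

Lemma rational_involution_ymx : rational_involution (ymx K).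
Proof.
split; apply/matrixP=> i j; rewrite !mxE.
- by rewrite rmorph_nat.
- by rewrite eq_sym.
rewrite !big_ord_recl big_ord0 !mxE.
by case: i j => [[|[|//]] ?] [[|[|//]] ?]; rewrite /= ?mulr0 ?mul0r ?mulr1 ?add0r ?addr0.
Qed.

Lemma rational_involution_tens (B : nat -> 'M[K]_2) n :
  (forall i, rational_involution (B i)) -> rational_involution (tens B n).
Proof.
move=> ratB; elim: n => [|n IHn]; first exact: rational_involution1.
exact/rational_involution_castsq/rational_involution_otimes.
Qed.

Lemma rational_involution_attens n c j :
  rational_involution c -> rational_involution (attens n c j).
Proof.
move=> ratc; apply: rational_involution_tens => i.
by case: ifP => _ //; apply: rational_involution1.
Qed.

(** There is a tensor factor besides the one in position [j], so the determinant is
    an even power of a sign. *)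
Lemma det_attens n c j : rational_involution c -> (1 < n)%N -> \det (attens n c j) = 1.
Proof.
case: n => [|[|n]] // ratc _; rewrite /attens /= det_castsq det_otimes.
set B := castsq _ _; set C := if _ then _ else _.
have /rational_involution_det-> : rational_involution B.
  exact: (rational_involution_attens n.+1 j ratc).
have ratC : rational_involution C by rewrite /C; case: ifP => _ //; apply: rational_involution1.
by rewrite expnS exprM rational_involution_det // expr1n mul1r.
Qed.

Lemma xygensP m gamma n A : A \in xygens K m gamma n ->
  exists2 c, rational_involution c &
  exists2 j, (j < n)%N & A = otimes 1%:M (attens gamma c j).
Proof.
rewrite mem_cat => /orP[] /mapP[j]; rewrite mem_iota => /= lt_jn ->.
  by exists (xmx K); [apply: rational_involution_xmx | exists j].
by exists (ymx K); [apply: rational_involution_ymx | exists j].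
Qed.

End Determinants.

Section InSL.
Variables (Fq : finFieldType) (K : closedFieldType) (FtoK : {rmorphism Fq -> K}).
Variable eta : int.
Local Notation Frob := (Frob FtoK eta).
Local Notation phi := (sfrob FtoK eta).
Local Notation GLfix := (GLfix FtoK eta).
Local Notation SL := (SL FtoK eta).

Lemma FdiagM n k (A B : 'M[K]_n) : A \in unitmx -> B \in unitmx ->
  Fdiag FtoK eta k (A *m B) = Fdiag FtoK eta k A *m Fdiag FtoK eta k B.
Proof.
move=> uA uB; rewrite /Fdiag mulmx_suml; apply: eq_bigr => i _.
rewrite mulmx_sumr (bigD1 i) //= big1 ?addr0 => [|j neq_ji].
  by rewrite otimesM mul_delta_mx iter_FrobM.
rewrite otimesM mul_delta_mx_0 1?eq_sym //.
by apply/matrixP=> r s; rewrite castmxE !mxE mul0r.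
Qed.

Lemma Fdiag_fixed n k (A : 'M[K]_n) :
  Frob A = A -> Fdiag FtoK eta k A = otimes A 1%:M.
Proof.
move=> fA; rewrite mx1_sum_delta otimes_sumr; apply: eq_bigr => i _.
by congr otimes; elim: (i : nat) => //= j ->.
Qed.

Lemma Fdiag_scalar n k (s : K) :
  Fdiag FtoK eta k (s%:M : 'M_n) = otimes 1%:M (torus FtoK eta k s).
Proof.
rewrite /torus diag_mx_sum_delta otimes_sumr; apply: eq_bigr => i _.
by rewrite iter_Frob_scalar otimes_scalarl mxE.
Qed.

Lemma det_Fdiag_group_set e n k :
  group_set [set A : GLfix e n | \det (Fdiag FtoK eta k (val A)) == 1].
Proof.
apply/group_setP; split=> [|x y]; rewrite ?inE.
  by rewrite GLfix_val1 Fdiag_fixed ?Frob1 // otimes1 det1.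
move=> /eqP dx /eqP dy.
by rewrite GLfix_valM FdiagM ?GLfix_unit // det_mulmx dx dy mulr1.
Qed.

Variables (zeta : nat -> K) (zeta4 : K) (g : forall alpha : nat, 'M[K]_(2 ^ alpha)).
Hypothesis ug : forall alpha, (0 < alpha)%N -> g alpha \in unitmx.

Lemma det_gconj n alpha (A : 'M[K]_(n * 2 ^ alpha)) : (0 < alpha)%N ->
  \det (gconj g A) = \det A.
Proof. by move=> a_gt0; apply: det_conjg_mx; rewrite otimes_unit ?unitmx1 ?ug. Qed.

(** The scalar [zeta] contributes its norm -1 to the power [m * 2 ^ gamma], which is
    even. The other generators have determinant 1 or -1, and it occurs once for each
    of the [2 ^ alpha] diagonal blocks, again an even number. *)
Lemma Rpos_sub_SL m alpha gamma : (0 < alpha)%N ->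
  \prod_(i < 2 ^ alpha) iter i phi (zeta alpha) = -1 -> ~~ odd (m * 2 ^ gamma) ->
  Rpos FtoK eta zeta g m alpha gamma \subset SL (m * 2 ^ (alpha + gamma)).
Proof.
move=> a_gt0 nz even_n; apply/subsetP=> B; rewrite !inE => /existsP[A /andP[RA /eqP ->]].
rewrite det_castsq det_gconj //.
have: A \in Group (det_Fdiag_group_set alpha (m * 2 ^ gamma) (2 ^ alpha)).
  move: A RA; apply/subsetP; rewrite gen_subG; apply/subsetP=> A.
  rewrite !inE => /orP[/eqP->|].
    by rewrite Fdiag_scalar det_otimes det1 expr1n mul1r det_torus nz -signr_odd (negPf even_n).
  case/(xygensP FtoK)=> c ratc [j _ ->].
  have ratA := rational_involution_otimes (rational_involution1 FtoK m)
    (rational_involution_attens gamma j ratc).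
  rewrite Fdiag_fixed ?rational_involution_Frob // det_otimes det1 expr1n mulr1.
  by rewrite -(prednK a_gt0) expnS exprM (rational_involution_det ratA) expr1n.
by rewrite inE => /eqP->.
Qed.

Lemma det_lastgen m gamma c : \det c = 1 -> \det (lastgen g m gamma c) = 1.
Proof.
move=> detc; rewrite det_castsq det_otimes det1 expr1n mul1r.
by rewrite -[_ *m _]/(conjg_mx (g 1 : 'M_2) c) det_conjg_mx ?ug // detc expr1n.
Qed.

Lemma det_mx2 (A : 'M[K]_2) : \det A = A 0 0 * A 1 1 - A 0 1 * A 1 0.
Proof.
rewrite (expand_det_row _ 0) !big_ord_recl big_ord0 addr0 /cofactor !det_mx11 !mxE.
rewrite /= expr0 expr1 mul1r mulN1r mulrN.
by congr (A _ _ * A _ _ - A _ _ * A _ _); apply: val_inj.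
Qed.

Lemma det_vmx : \det (vmx K) = 1.
Proof. by rewrite det_mx2 !mxE /= oppr0 mulr0 opprK mul1r sub0r opprK. Qed.

Lemma det_zmx : zeta4 != 0 -> \det (zmx zeta4) = 1.
Proof. by move=> nz; rewrite det_mx2 !mxE /= mulr0 subr0 mulfV. Qed.

Lemma Smx_sub_SL m gamma :
  Rpos FtoK eta zeta g m 1 gamma \subset SL (m * 2 ^ (1 + gamma)) ->
  Smx FtoK eta zeta g m gamma \subset SL (m * 2 ^ gamma.+1).
Proof.
move=> sRS; rewrite gen_subG subUset sRS /=; apply/subsetP=> A; rewrite !inE.
by move=> /eqP eA; rewrite [val A]eA det_lastgen // det_vmx.
Qed.

Lemma Eplus_sub_SL m gamma : (1 < gamma)%N ->
  Eplus FtoK eta m gamma \subset SL (m * 2 ^ gamma).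
Proof.
move=> g_gt1; rewrite gen_subG; apply/subsetP=> A; rewrite !inE.
case/(xygensP FtoK)=> c ratc [j _ ->].
by rewrite det_otimes det1 (det_attens j ratc) // !expr1n mulr1.
Qed.

Lemma Eminus_sub_SL m gamma : zeta4 != 0 ->
  Eminus FtoK eta zeta4 g m gamma \subset SL (m * 2 ^ gamma).
Proof.
move=> nz4; case: gamma => [|gamma]; first exact: sub1G.
rewrite gen_subG; apply/subsetP=> A; rewrite !inE.
case/or3P=> [/eqP->|/eqP->|]; rewrite ?det_lastgen ?det_vmx ?det_zmx //.
case/(xygensP FtoK)=> c ratc [j lt_j ->].
rewrite det_otimes det1 (det_attens j ratc) ?expr1n ?mulr1 // ltnS.
exact: leq_ltn_trans lt_j.
Qed.

End InSL.

(** * Semidihedral relations and quadratic relations *)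

Section Semidihedral.
Variables (gT : finGroupType) (z v : gT) (h : nat).
Local Open Scope group_scope.
Hypotheses (v2 : v ^+ 2 = z ^+ h) (z_h2 : z ^+ (h * 2) = 1)
  (vzv : v * z * v^-1 = z ^+ h * z^-1).

Lemma semidihedral_norm : v \in 'N(<[z]>).
Proof.
rewrite -groupV inE -cycleJ cycle_subG conjgE invgK mulgA vzv.
by rewrite groupM ?groupV ?mem_cycle ?cycle_id.
Qed.

Lemma semidihedral_elt r : r \in <<[set z; v]>> ->
  r \in <[z]> \/ exists l, r = z ^+ l * v.
Proof.
rewrite -joingE -joing_idl -joing_idr norm_joinEr; last first.
  by rewrite cycle_subG semidihedral_norm.
case/mulsgP=> _ _ /cycleP[i ->] /cycleP[j ->] ->.
rewrite -(odd_double_half j) expgD -mul2n expgM v2 -expgM.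
case: (odd j); [right | left]; last by rewrite mul1g groupM ?mem_cycle.
exists (i + h * j./2)%N; rewrite expg1 expgD -!mulgA; congr (_ * _).
rewrite expgM -v2; apply: commuteX; exact: commuteX.
Qed.

(** Conjugation by [v] inverts [z ^+ l] up to a power of the involution [z ^+ h], so
    the square is itself a power of that involution. *)
Lemma semidihedral_sqr l :
  ((z ^+ l * v) ^+ 2 \in <[z]>) /\ (z ^+ l * v) ^+ (2 * 2) = 1.
Proof.
have sqr : (z ^+ l * v) ^+ 2 = z ^+ (h * l.+1).
  have vzl : v * z ^+ l * v^-1 = z ^+ (h * l) * z ^- l.
    have := conjXg z v^-1 l; rewrite !conjgE invgK !mulgA vzv => ->.
    by rewrite expgMn ?expgVn ?expgM //; exact/commuteV/commute_sym/commuteX.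
  have -> : (z ^+ l * v) ^+ 2 = z ^+ l * (v * z ^+ l * v^-1) * v ^+ 2.
    by rewrite !expgS !expg0 !mulg1 !mulgA mulgKV.
  have zC : commute (z ^+ l) (z ^+ (h * l)) by exact/commuteX2/commute_refl.
  by rewrite vzl v2 mulgA zC mulgK -expgD mulnS addnC.
split; first by rewrite sqr mem_cycle.
by rewrite expgM sqr -expgM mulnAC expgM z_h2 expg1n.
Qed.

End Semidihedral.

Section MatrixCore.
Variables (K : fieldType) (N : nat).
Hypotheses (N_gt0 : (0 < N)%N) (nz2 : 2%:R != 0 :> K).
Implicit Types X Y Z W : 'M[K]_N.

Lemma mx_double_inj X Y : X + X = Y + Y -> X = Y.
Proof.
move=> eqXY; apply/eqP; rewrite -subr_eq0.
have : 2%:R *: (X - Y) == 0 by rewrite scaler_nat mulr2n addrACA eqXY addrACA !subrr addr0.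
by rewrite scaler_eq0 (negPf nz2).
Qed.

Lemma mul_1D_1B X : X * X = -1 -> (1 + X) * (1 - X) = 1 + 1.
Proof. by move=> XX; rewrite mulrDl mul1r mulrBr mulr1 XX opprK addrA subrK. Qed.

Lemma mul_1B_1D X : X * X = -1 -> (1 - X) * (1 + X) = 1 + 1.
Proof. by move=> XX; rewrite mulrBl mul1r mulrDr mulr1 XX opprD opprK addrA addrK. Qed.

(** [W] is the conjugate of [Z] by [(1 + X) (1 + Y)]. The factor [1 + Y] commutes
    with [Z] and [W], and [Z (1 + X) = (1 - X) Z], while the inverse of
    [1 + X] is half of [1 - X]. *)
Lemma anticommute_conj X Y Z W : X * X = -1 -> Y * Y = -1 ->
  Z * X = - (X * Z) -> Z * Y = Y * Z -> W * Y = Y * W ->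
  (1 + X) * (1 + Y) * W = Z * ((1 + X) * (1 + Y)) -> W = - (X * Z).
Proof.
move=> XX YY ZX ZY WY eqW.
have WP : (1 + Y) * W = W * (1 + Y) by rewrite mulrDl mulrDr mul1r mulr1 WY.
have PW : (1 + X) * W = (1 - X) * Z.
  have -> : (1 - X) * Z = Z * (1 + X) by rewrite mulrBl mulrDr mul1r mulr1 ZX.
  have := congr1 (fun V => V * (1 - Y)) eqW.
  rewrite -(mulrA (1 + X)) WP !mulrA -!(mulrA _ (1 + Y)) mul_1D_1B //.
  by rewrite !mulrDr !mulr1; apply: mx_double_inj.
apply: mx_double_inj; rewrite -[W in LHS]mul1r -mulrDl -(mul_1B_1D XX).
rewrite -mulrA PW mulrA mulrBl mul1r mulrBr mulr1 XX opprK.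
by rewrite [X + 1]addrC opprD addrACA subrr add0r mulrDl mulNr.
Qed.

(** [Z] and [- Y] are the two roots of [T ^ 2 = t T + 1], so the sums of their
    n-th powers satisfy a linear recurrence and are scalars. For odd [i] this gives
    [t W = Z ^ (2 i) - 1 = Z ^ i (Z ^ i - Y ^ i)], a scalar multiple of [Z ^ i], and
    comparing squares shows that [W] is [Z ^ i] up to sign. *)
Lemma quadratic_root_pow Z Y W (t : K) i : t != 0 -> odd i ->
  Z - Y = t%:M -> Z * Y = 1 -> Y * Z = 1 ->
  W * W = t *: W + 1 -> W * W = Z ^+ (2 * i) -> W = Z ^+ i \/ W = - Z ^+ i.
Proof.
move=> nzt i_odd ZYt ZY YZ W2 W2Z.
have rec n : exists c d : K, Z ^+ n + (- Y) ^+ n = c%:M /\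
   Z ^+ n.+1 + (- Y) ^+ n.+1 = d%:M.
  elim: n => [|n [c [d [Dc Dd]]]].
    exists (1 + 1), t; split; last by rewrite !expr1.
    by rewrite !expr0 raddfD.
  exists d, (t * d + c); split=> //.
  have ZZ : Z * Z = t *: Z + 1.
    by rewrite -mul_scalar_mx -ZYt -[_ *m _]/(_ * _) mulrBl YZ subrK.
  have YY : (- Y) * (- Y) = t *: (- Y) + 1.
    rewrite -mul_scalar_mx -ZYt -[_ *m _]/(_ * _) mulrBl !mulrN mulNr opprK ZY.
    by rewrite addrAC addNr add0r.
  have step X n' : X * X = t *: X + 1 -> X ^+ n'.+2 = t *: X ^+ n'.+1 + X ^+ n'.
    move=> XX; rewrite !exprS mulrA XX mulrDl mul1r; congr (_ + _).
    exact: (esym (scalemxAl _ _ _)).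
  rewrite !step // addrACA -scalerDr Dd Dc scale_scalar_mx.
  by rewrite raddfD.
have [c [_ [Dc _]]] := rec i.
have ZiYi : Z ^+ i * Y ^+ i = 1 by rewrite -exprMn_comm ?ZY ?expr1n // /GRing.comm ZY YZ.
have tW : t *: W = c *: Z ^+ i.
  apply: (addIr 1); rewrite -W2 W2Z mul2n -addnn exprD -ZiYi.
  rewrite -mul_mx_scalar -Dc -[_ *m _]/(_ * _) mulrDr exprNn -signr_odd i_odd.
  by rewrite expr1 mulN1r mulrN subrK.
have DW : W = (t^-1 * c) *: Z ^+ i by rewrite -scalerA -tW scalerA mulVf // scale1r.
have : (t^-1 * c) ^+ 2 == 1.
  have /matrixP/(_ (Ordinal N_gt0) (Ordinal N_gt0)) :
      ((t^-1 * c) ^+ 2)%:M = 1%:M :> 'M[K]_N.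
    have ZYi : Z ^+ (2 * i) * (Y ^+ i * Y ^+ i) = 1.
      by rewrite mul2n -addnn exprD -mulrA (mulrA _ (Y ^+ i)) ZiYi mul1r ZiYi.
    (* The scalar acts trivially on [Z ^+ (2 * i)], which has an inverse. *)
    have WW : (t^-1 * c) ^+ 2 *: Z ^+ (2 * i) = Z ^+ (2 * i).
      rewrite -{2}W2Z DW -[RHS]scalemxAl -[in RHS]scalemxAr scalerA -expr2.
      by rewrite mul2n -addnn exprD.
    by rewrite -scalemx1 -[1%:M]/(1 : 'M_N) -ZYi [LHS]scalemxAl WW.
  by rewrite !mxE eqxx /= !mulr1n => ->.
by rewrite sqrf_eq1 DW => /orP[] /eqP ->; [left | right]; rewrite ?scaleN1r ?scale1r.
Qed.

End MatrixCore.

(** * Normalizers of the intersections with SL *)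

Section Normalizers.
Variables (Fq : finFieldType) (K : closedFieldType) (FtoK : {rmorphism Fq -> K}).
Variables (eta : int) (N : nat).
Hypotheses (N_gt0 : (0 < N)%N) (nz2 : 2%:R != 0 :> K).
Local Notation gT := (GLfix FtoK eta 0 N).
Implicit Types (x y z v n e : gT).

Lemma val_conj_scalar x y (s : K) : val x = s%:M -> val (x ^ y)%g = s%:M.
Proof.
by move=> xs; rewrite GLfix_valJ xs mul_mx_scalar -scalemxAl mulVmx ?GLfix_unit // scalemx1.
Qed.

Lemma mx_N1_neq1 : (- 1%:M : 'M[K]_N) <> 1%:M.
Proof.
move=> /matrixP/(_ (Ordinal N_gt0) (Ordinal N_gt0)) /eqP.
by rewrite !mxE eqxx mulr1n -subr_eq0 -opprD oppr_eq0 -mulr2n (negPf nz2).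
Qed.

Lemma GLfix_neq_opp x : val x <> - val x.
Proof.
move=> xN; have ux := GLfix_unit x.
by apply: mx_N1_neq1; rewrite -(mulmxV ux) -mulNmx -xN.
Qed.

Lemma sqr_neg_one e : val e = - 1%:M -> (e * e = 1)%g.
Proof. by move=> De; apply: val_inj; rewrite /= -[GLfix_mx e]/(val e) De mulmxN mulmx1 opprK. Qed.

(** The quadratic relation of [z] expresses [z] through its square, and a conjugate
    of [z] satisfies the same relation. Hence if the square of the conjugate is a
    power of [z], then so is the conjugate up to sign, and -1 is a power of [z]. *)
Lemma conj_sqr_mem_cycle z n (t : K) h : t != 0 ->
  val z - val z^-1%g = t%:M -> val z ^+ (h * 2) = - 1%:M ->
  ((z ^+ 2) ^ n \in <[z]> -> z ^ n \in <[z]>)%g.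
Proof.
move=> nzt zt zh /cycleP[l Dl].
pose e := (z ^+ (h * 2))%g; have De : val e = (-1)%:M by rewrite GLfix_valX zh raddfN.
have eN1 : val e = - 1%:M by rewrite De raddfN.
have ee := sqr_neg_one eN1.
have e_neq1 : e != 1%g.
  by apply/negP=> /eqP e1; apply: mx_N1_neq1; rewrite -eN1 e1.
have eX r : (e ^+ r = if odd r then e else 1)%g.
  rewrite -{1}(odd_double_half r) expgD -mul2n expgM (expgS e 1) expg1 ee expg1n mulg1.
  by case: (odd r).
have en : (e ^ n = e)%g by apply: val_inj; rewrite (val_conj_scalar n De) De.
(* Comparing which powers equal -1 shows that [l] is twice an odd number. *)
have el : (z ^+ (l * h) = e)%g by rewrite expgM -Dl -conjXg -expgM mulnC en.
have l_even : ~~ odd l.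
  apply/negP=> l_odd; case/eqP: e_neq1.
  by have := ee; rewrite -{1 2}el -expgD addnn -muln2 -mulnA mulnC expgM eX l_odd.
have Dl2 : l = (2 * l./2)%N by rewrite mul2n even_halfK.
have i_odd : odd l./2.
  apply: contraNT e_neq1 => i_even.
  by rewrite -el Dl2 mulnAC (mulnC 2) expgM eX (negPf i_even).
have uz := GLfix_unit z; have un := GLfix_unit n.
have [|||||] := @quadratic_root_pow K N N_gt0
  (val z) (val z^-1%g) (val (z ^ n)%g) t l./2 nzt i_odd zt.
- by rewrite GLfix_valV; apply: mulmxV.
- by rewrite GLfix_valV; apply: mulVmx.
- have zz : val z *m val z = t *: val z + 1%:M.
    rewrite -mul_scalar_mx -zt mulmxBl GLfix_valV mulVmx // subrK //.
  rewrite -[LHS]/(val (z ^ n * z ^ n)%g) -conjMg !GLfix_valJ GLfix_valM zz.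
  by rewrite mulmxDr mulmxDl mulmx1 mulVmx // -scalemxAr -scalemxAl.
- rewrite -[LHS]/(val (z ^ n * z ^ n)%g) -conjMg -[(z * z)%g]/(z ^+ 2)%g Dl.
  by rewrite GLfix_valX -Dl2.
- rewrite -GLfix_valX => /val_inj ->; exact: mem_cycle.
move=> zni; rewrite (_ : z ^ n = e * z ^+ l./2)%g ?groupM ?mem_cycle //.
by apply: val_inj; rewrite zni GLfix_valM eN1 mulNmx mul1mx GLfix_valX.
Qed.

Lemma norm_meet_cyclic z (t : K) h (H : {set gT}) : t != 0 ->
  val z - val z^-1%g = t%:M -> val z ^+ (h * 2) = - 1%:M ->
  (z ^+ 2 \in H -> 'N(<[z]> :&: H) \subset 'N(<[z]>))%g.
Proof.
move=> nzt zt zh Hz2; apply/subsetP=> n nSn.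
rewrite inE -cycleJ cycle_subG; apply: (conj_sqr_mem_cycle nzt zt zh).
have: ((z ^+ 2) ^ n \in <[z]> :&: H)%g by rewrite memJ_norm // inE Hz2 mem_cycle.
by case/setIP.
Qed.

Lemma semidihedral_relations z v H : val z ^+ H = - 1%:M ->
  val v *m val v = - 1%:M -> val v *m val z = - (val z^-1%g *m val v) ->
  [/\ v ^+ 2 = z ^+ H, z ^+ (H * 2) = 1 & v * z * v^-1 = z ^+ H * z^-1]%g.
Proof.
move=> zH vv vz; have e1 : val (z ^+ H)%g = - 1%:M by rewrite GLfix_valX.
split; first by apply: val_inj; rewrite e1.
  by rewrite expgM; apply: sqr_neg_one.
apply: (canLR (mulgK v)); apply: val_inj.
by rewrite !GLfix_valM vz e1 mulNmx mul1mx mulNmx.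
Qed.

(** Every conjugate of [z ^+ 2] by an element that normalizes the intersection must
    lie in [<[z]>]: the elements outside have fourth power 1, but [z ^+ 8] is not 1
    since -1 is the power [h * 8] of [z]. *)
Lemma norm_meet_semidihedral z v (t : K) h (L : {group gT}) : t != 0 ->
  val z - val z^-1%g = t%:M -> val z ^+ (h * 4 * 2) = - 1%:M ->
  val v *m val v = - 1%:M -> val v *m val z = - (val z^-1%g *m val v) ->
  (z ^+ 2 \in L -> v \in L ->
    'N(<<[set z; v]>> :&: L) \subset 'N(<<[set z; v]>>))%g.
Proof.
move=> nzt zt zh vv vz Lz2 Lv; apply/subsetP=> n nSn.
have [v2 zz vzv] := semidihedral_relations zh vv vz.
have [Rz Rv] : z \in <<[set z; v]>>%g /\ v \in <<[set z; v]>>%g.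
  by split; apply: mem_gen; rewrite !inE eqxx ?orbT.
have zn : (z ^ n \in <[z]>)%g.
  apply: (conj_sqr_mem_cycle nzt zt zh).
  have: ((z ^+ 2) ^ n \in <<[set z; v]>> :&: L)%g by rewrite memJ_norm // inE Lz2 groupX.
  case/setIP=> /(semidihedral_elt v2 vzv)[//|[l zv]] _.
  have [_] := semidihedral_sqr v2 zz vzv l; rewrite -zv -conjXg => /eqP.
  rewrite conjg_eq1 -expgM -[(2 * (2 * 2))%N]/(4 * 2)%N => /eqP z8.
  case: mx_N1_neq1; rewrite -zh -mulnA mulnC -GLfix_valX expgM z8 expg1n.
  exact: GLfix_val1.
rewrite inE -genJ gen_subG; apply/subsetP=> _ /imsetP[x + ->].
rewrite !inE => /orP[] /eqP->; first by apply: subsetP zn; rewrite cycle_subG.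
have: (v ^ n \in <<[set z; v]>> :&: L)%g by rewrite memJ_norm // inE Rv.
by case/setIP.
Qed.

Lemma half_product_GLfix x y : val x *m val x = - 1%:M -> val y *m val y = - 1%:M ->
  exists c : gT, val c = (2%:R^-1 : K) *: ((1%:M + val x) *m (1%:M + val y)).
Proof.
move=> xx yy; have [uC fC] := Frob_half_product nz2 xx yy (Frob_GLfix x) (Frob_GLfix y).
by exists (MkGLfix (isGLfix_fixed 0 uC fC)).
Qed.

Lemma unscale_conj c z (V : 'M[K]_N) : val c = (2%:R^-1 : K) *: V ->
  V *m val (z ^ c)%g = val z *m V.
Proof.
move=> Dc; have := congr1 val (conjgC z c); rewrite !GLfix_valM Dc.
rewrite -scalemxAl -scalemxAr => /esym; apply: scalerI.
by rewrite invr_eq0.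
Qed.

(** The centralizer of [z ^+ 2] is larger than that of [z]. It contains half of
    [(1 + x) (1 + y)], where [y] is a power of [z] of order 4, without
    which the element would not be fixed by F for [eta = -1]. It conjugates [z] to
    [- x z], which does not commute with [z]. *)
Lemma not_norm_meet_cyclic z x h (H : {set gT}) :
  val x *m val x = - 1%:M -> val z *m val x = - (val x *m val z) ->
  val z ^+ (h * 2 * 2) = - 1%:M -> (<[z]> :&: H \subset <[z ^+ 2]>)%g ->
  ~ ('N(<[z]> :&: H) \subset 'N(<[z]>))%g.
Proof.
move=> xx zx zh sH sNN; pose y := (z ^+ (h * 2))%g.
have yy : val y *m val y = - 1%:M by rewrite GLfix_valX -zh (exprM _ (h * 2)).
have [c Dc] := half_product_GLfix xx yy.
have xz2 : (commute x (z ^+ 2))%g.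
  apply: val_inj; suff: val x *m (val z *m val z) = val z *m val z *m val x by [].
  by rewrite -[RHS]mulmxA zx mulmxN [in RHS]mulmxA zx mulNmx opprK mulmxA.
have yz2 : (commute y (z ^+ 2))%g by exact/commuteX2/commute_refl.
have cz2 : (commute c (z ^+ 2))%g.
  have comm1 (u : gT) : commute u (z ^+ 2)%g ->
      (1%:M + val u) *m val (z ^+ 2)%g = val (z ^+ 2)%g *m (1%:M + val u).
    move=> uz2; rewrite mulmxDl mulmxDr mul1mx mulmx1; congr (_ + _).
    exact: (congr1 val uz2).
  apply: val_inj; rewrite !GLfix_valM Dc -scalemxAl -scalemxAr; congr (_ *: _).
  by rewrite -mulmxA comm1 // mulmxA comm1 // mulmxA.
have cS : c \in 'N(<[z]> :&: H)%g.
  apply: subsetP (cent_sub _) _ _; apply: subsetP (centS sH) _ _.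
  by rewrite cent_cycle; apply/cent1P.
have: (z ^ c \in <[z]>)%g by rewrite memJ_norm ?cycle_id // (subsetP sNN).
case/cycleP=> l Dl; have commz : commute (z ^ c)%g z by rewrite Dl; exact/commute_sym/commuteX.
have Dzc : val (z ^ c)%g = - (val x *m val z).
  have zy : (z * y = y * z)%g by exact/commuteX.
  have zcy : (z ^ c * y = y * z ^ c)%g by exact/commuteX.
  apply: (@anticommute_conj K N nz2 (val x) (val y) (val z)) => //.
  - exact: (congr1 val zy).
  - exact: (congr1 val zcy).
  exact: unscale_conj Dc.
apply: (@GLfix_neq_opp (x * z * z)%g); rewrite !GLfix_valM.
have: val (z ^ c)%g *m val z = val z *m val (z ^ c)%g := congr1 val commz.
rewrite Dzc !mulNmx mulmxN => /oppr_inj {1}->.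
by rewrite mulmxA zx mulNmx.
Qed.

(** [c] is the Hurwitz unit half of [1 + i + v + i v], which permutes [i], [i v] and
    [v] cyclically. *)
Lemma quaternion_rotate (i v c : gT) :
  val i *m val i = - 1%:M -> val v *m val v = - 1%:M ->
  val v *m val i = - (val i *m val v) ->
  val c = (2%:R^-1 : K) *: ((1%:M + val i) *m (1%:M + val v)) ->
  (i ^ c = i * v /\ v ^ c = i)%g.
Proof.
move=> ii vv vi Dc; set P := _ *m _ in Dc.
have DP : P = 1%:M + val i + val v + val i *m val v.
  by rewrite /P mulmxDl mul1mx mulmxDr mulmx1 addrA (addrAC 1%:M).
have ivi : val i *m val v *m val i = val v.
  by rewrite -mulmxA vi mulmxN mulmxA ii mulNmx mul1mx opprK.
have Pi : P *m val i = val i - 1%:M - val i *m val v + val v.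
  by rewrite DP !mulmxDl mul1mx ii vi ivi.
have intertwine (x y : gT) : val x *m P = P *m val y -> (x ^ c = y)%g.
  move=> xP; apply: (can_inj (mulKg c)); rewrite -conjgC; apply: val_inj.
  by rewrite !GLfix_valM Dc -scalemxAl -scalemxAr xP.
split; apply: intertwine.
  rewrite GLfix_valM mulmxA Pi mulmxDl !mulmxBl mul1mx -mulmxA vv mulmxN mulmx1 opprK.
  rewrite DP !mulmxDr mulmx1 ii mulmxA ii mulNmx mul1mx.
  by rewrite [LHS](ACl (3*4*1*2))%AC.
rewrite Pi DP !mulmxDr mulmx1 vv mulmxA vi mulNmx -mulmxA vv mulmxN mulmx1 opprK.
by rewrite [RHS](ACl (4*3*2*1))%AC.
Qed.

(** Here [z ^+ 2] and [v] generate a quaternion group of order 8, and the Hurwitz unit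
    above normalizes it. The squares of all elements of [<<[set z; v]>>] lie in
    [<[z]>], whereas the conjugate of [z] by that unit has square [z ^+ 2 * v]. *)
Lemma not_norm_meet_semidihedral z v (H : {set gT}) :
  val z ^+ 4 = - 1%:M -> val v *m val v = - 1%:M ->
  val v *m val z = - (val z^-1%g *m val v) ->
  (<<[set z; v]>> :&: H = <<[set z ^+ 2; v]>> ->
   ~ ('N(<<[set z; v]>> :&: H) \subset 'N(<<[set z; v]>>)))%g.
Proof.
move=> z4 vv vz ->; set i := (z ^+ 2)%g; set S := <<_>>%g => sNN.
have [v2 z8 vzv] := semidihedral_relations z4 vv vz.
have ii : val i *m val i = - 1%:M by rewrite /i GLfix_valX -z4 (exprM _ 2 2).
have vi : val v *m val i = - (val i *m val v).
  have vz3 : (v * z = z ^+ 3 * v)%g.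
    by rewrite -[LHS](mulgKV v) -(mulgA _ v^-1%g) mulgA vzv expgSr mulgK.
  have viv : (v * i = z ^+ 4 * (i * v))%g.
    have -> : i = (z * z)%g by [].
    by rewrite mulgA vz3 -(mulgA _ v) vz3 !mulgA -!expgSr.
  have -> : val v *m val i = val (z ^+ 4)%g *m (val i *m val v) := congr1 val viv.
  by rewrite GLfix_valX z4 mulNmx mul1mx.
have [c Dc] := half_product_GLfix ii vv.
have [ic vc] := quaternion_rotate ii vv vi Dc.
have [Si Sv] : i \in S /\ v \in S by split; apply: mem_gen; rewrite !inE eqxx ?orbT.
have nSc : c \in 'N(S)%g.
  rewrite inE -genJ gen_subG; apply/subsetP=> _ /imsetP[x + ->].
  by rewrite !inE => /orP[] /eqP->; [rewrite ic; apply: (groupM Si Sv) | rewrite vc; apply: Si].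
have: (z ^ c \in <<[set z; v]>>)%g.
  by rewrite memJ_norm ?(subsetP sNN) // mem_gen // !inE eqxx.
have sqr_cycle r : (r \in <<[set z; v]>> -> r ^+ 2 \in <[z]>)%g.
  case/(semidihedral_elt v2 vzv)=> [|[l ->]]; first exact: groupX.
  by have [] := semidihedral_sqr v2 z8 vzv l.
move/sqr_cycle; rewrite -conjXg ic => /cycleP[l Dl].
have comm_ivi : commute (i * v)%g i by rewrite Dl; exact/commuteX2/commute_refl.
have vi_iv : (v * i = i * v)%g by apply: (mulgI i); rewrite mulgA comm_ivi.
by apply: (@GLfix_neq_opp (i * v)%g); rewrite -{1}vi_iv; apply: vi.
Qed.

End Normalizers.

(** * The subgroups with a determinant different from 1 *)

Section Inflation.
Variables (Fq : finFieldType) (K : closedFieldType) (FtoK : {rmorphism Fq -> K}).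
Variables (eta : int) (m alpha gamma : nat).
Local Notation Frob := (Frob FtoK eta).
Implicit Types X Y : 'M[K]_(2 ^ alpha).

Definition inflate X : 'M[K]_(m * 2 ^ (alpha + gamma)) :=
  castsq (deg_subproof m alpha gamma) (otimes (1%:M : 'M_(m * 2 ^ gamma)) X).

Lemma inflateM X Y : inflate (X *m Y) = inflate X *m inflate Y.
Proof. by rewrite /inflate -castsqM otimesM mulmx1. Qed.

Lemma inflate1 : inflate 1%:M = 1%:M.
Proof. by rewrite /inflate otimes1 castsq_scalar. Qed.

Lemma inflateD X Y : inflate (X + Y) = inflate X + inflate Y.
Proof. by rewrite /inflate otimesDr castsqD. Qed.

Lemma inflateZ s X : inflate (s *: X) = s *: inflate X.
Proof. by rewrite /inflate otimesZr castsqZ. Qed.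

Lemma inflateN X : inflate (- X) = - inflate X.
Proof. by rewrite -scaleN1r inflateZ scaleN1r. Qed.

Lemma inflate_scalar s : inflate s%:M = s%:M.
Proof. by rewrite -scalemx1 inflateZ inflate1 scalemx1. Qed.

Lemma inflateX X n : inflate (X ^+ n) = inflate X ^+ n.
Proof.
elim: n => [|n IHn]; first exact: inflate1.
by rewrite !exprS [LHS]inflateM IHn.
Qed.

Lemma inflate_unit X : X \in unitmx -> inflate X \in unitmx.
Proof. by move=> uX; rewrite castsq_unit otimes_unit ?unitmx1. Qed.

Lemma Frob_inflate X : X \in unitmx -> Frob (inflate X) = inflate (Frob X).
Proof. by move=> uX; rewrite Frob_castsq Frob_otimes ?unitmx1 ?Frob1. Qed.

Lemma det_inflate X : \det (inflate X) = \det X ^+ (m * 2 ^ gamma).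
Proof. by rewrite det_castsq det_otimes det1 expr1n mul1r. Qed.

Lemma inflateP X : X \in unitmx -> Frob X = X ->
  exists x : GLfix FtoK eta 0 (m * 2 ^ (alpha + gamma)), val x = inflate X.
Proof.
move=> uX fX; have fL : Frob (inflate X) = inflate X by rewrite Frob_inflate // fX.
by exists (MkGLfix (isGLfix_fixed 0 (inflate_unit uX) fL)).
Qed.

End Inflation.

Section Model.
Variables (Fq : finFieldType) (K : closedFieldType) (FtoK : {rmorphism Fq -> K}).
Variable eta : int.
Hypotheses (eta_sign : eta = 1 \/ eta = -1) (dvd4 : (4 %| #|Fq|%:Z + eta)%Z).
Variable a : nat.
Hypothesis def_a : a = logn 2 (absz (#|Fq|%:Z + eta)).
Variable zeta : nat -> K.
Hypothesis zetaP : forall alpha, (0 < alpha)%N ->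
  (2 ^ (a + alpha)).-primitive_root (zeta alpha).
Variable g : forall alpha, 'M[K]_(2 ^ alpha).
Hypothesis gP : forall alpha, (0 < alpha)%N ->
    \det (g alpha) = 1 /\
    invmx (g alpha) *m Frob FtoK eta (g alpha) = wmx K (2 ^ alpha).
Variable m : nat.
Hypothesis m_gt0 : (0 < m)%N.
Local Notation phi := (sfrob FtoK eta).
Local Notation GLfix := (GLfix FtoK eta).

Lemma g_unit alpha : (0 < alpha)%N -> g alpha \in unitmx.
Proof. by case/gP=> dg _; rewrite unitmxE dg unitr1. Qed.

Lemma two_neq0 : 2%:R != 0 :> K.
Proof.
by rewrite (prim_root_dvd_eq0 (zetaP (isT : 0 < 1)%N)) // addn1 expnS dvdn_mulr.
Qed.

Section FixAlpha.
Variable alpha : nat.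
Hypothesis alpha_gt0 : (0 < alpha)%N.
Local Notation N := (m * 2 ^ (alpha + 0))%N.

Let ug := g_unit alpha_gt0.
Let gF := (gP alpha_gt0).2.
Let period := iter_sfrob_period FtoK eta_sign dvd4 def_a alpha_gt0 (zetaP alpha_gt0).

Definition big_torus s : 'M[K]_N :=
  inflate m 0 (conjg_mx (g alpha) (torus FtoK eta (2 ^ alpha) s)).

Definition big_shift : 'M[K]_N := inflate m 0 (conjg_mx (g alpha) (wmx K (2 ^ alpha))).

Lemma big_torusM s t : big_torus (s * t) = big_torus s *m big_torus t.
Proof. by rewrite /big_torus torusM conjg_mxM // inflateM. Qed.

Lemma big_torus1 : big_torus 1 = 1%:M.
Proof. by rewrite /big_torus torus1 conjg_mx_scalar // inflate1. Qed.

Lemma big_torusN s : big_torus (- s) = - big_torus s.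
Proof. by rewrite /big_torus torusN /conjg_mx mulmxN mulNmx inflateN. Qed.

Lemma big_torusX s n : big_torus (s ^+ n) = big_torus s ^+ n.
Proof. by rewrite /big_torus torusX conjg_mxX // inflateX. Qed.

Lemma big_torusV s : s != 0 -> invmx (big_torus s) = big_torus s^-1.
Proof.
move=> nzs; have sV : big_torus s *m big_torus s^-1 = 1%:M.
  by rewrite -big_torusM mulfV // big_torus1.
have [us _] := mulmx1_unit sV.
by rewrite -[LHS]mulmx1 -sV mulKmx.
Qed.

Lemma zeta_neq0 : zeta alpha != 0.
Proof. by rewrite (prim_root_eq0 (zetaP alpha_gt0)) expn_eq0. Qed.

Lemma torus_generator : exists z : GLfix 0 N, val z = big_torus (zeta alpha).
Proof.
apply: inflateP; first by rewrite conjg_mx_unit // torus_unit ?zeta_neq0.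
exact: (Frob_conjg_torus ug gF zeta_neq0 period).
Qed.

Lemma shift_generator : exists u : GLfix 0 N, val u = big_shift.
Proof.
apply: inflateP; first by rewrite conjg_mx_unit // wmx_unit.
exact: (Frob_conjg_wmx ug gF).
Qed.

Lemma big_shift_torus n s : iter (2 ^ alpha) phi s = s ->
  big_shift ^+ n *m big_torus (iter n phi s) = big_torus s *m big_shift ^+ n.
Proof.
move=> fs; rewrite /big_shift -inflateX -conjg_mxX // -!inflateM -!conjg_mxM //.
by rewrite wmxX_torus.
Qed.

Lemma big_shift_order : big_shift ^+ (2 ^ alpha) = - 1%:M.
Proof.
rewrite /big_shift -inflateX -conjg_mxX // wmx_order.
by rewrite /conjg_mx mulmxN mulNmx mulmx1 mulmxV // inflateN inflate1.
Qed.

Lemma torus_generator_order z H : val z = big_torus (zeta alpha) ->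
  H = (2 ^ (a + alpha).-1)%N -> val (z : GLfix 0 N) ^+ H = - 1%:M.
Proof.
move=> -> ->; rewrite -big_torusX prim_expr_half ?big_torusN ?big_torus1 //.
by rewrite prednK ?zetaP // addn_gt0 alpha_gt0 orbT.
Qed.

Lemma torus_generator_det z : odd m -> val z = big_torus (zeta alpha) ->
  \det (val (z : GLfix 0 N)) = -1.
Proof.
move=> m_odd ->; rewrite det_inflate det_conjg_mx // det_torus.
rewrite (prod_iter_sfrob FtoK eta_sign dvd4 def_a) ?zetaP //.
by rewrite muln1 -signr_odd m_odd.
Qed.

Lemma Rpos_cycle z : val z = big_torus (zeta alpha) ->
  Rpos FtoK eta zeta g m alpha 0 = <[z : GLfix 0 N]>%g.
Proof.
move=> Dz.
have fixA : isGLfix FtoK eta alpha ((zeta alpha)%:M : 'M_(m * 2 ^ 0)).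
  rewrite /isGLfix iter_Frob_scalar period eqxx andbT unitmxE det_scalar unitrX //.
  by rewrite unitfE zeta_neq0.
pose A : GLfix alpha (m * 2 ^ 0) := MkGLfix fixA.
have DA : val A = (zeta alpha)%:M by [].
have DR0 : R0 FtoK eta zeta m alpha 0 = <[A]>%g.
  rewrite /R0 /subgen; congr <<_>>%g; apply/setP=> B.
  rewrite !inE.
  exact: (inj_eq val_inj B A).
have DAl l : castsq (deg_subproof m alpha 0)
    (gconj g (Fdiag FtoK eta (2 ^ alpha) (val (A ^+ l)%g))) = val (z ^+ l)%g.
  rewrite !GLfix_valX DA Dz -big_torusX.
  have -> : (zeta alpha)%:M ^+ l = (zeta alpha ^+ l)%:M :> 'M_(m * 2 ^ 0) by rewrite rmorphXn.
  rewrite Fdiag_scalar /gconj otimesM otimesV ?unitmx1 // otimesM mulmx1.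
  by rewrite mul1mx invmx1.
apply/setP=> B; rewrite inE DR0; apply/existsP/cycleP.
  by case=> _ /andP[/cycleP[l ->] /eqP]; rewrite DAl => /val_inj; exists l.
by case=> l ->; exists (A ^+ l)%g; rewrite mem_cycle DAl /=.
Qed.

End FixAlpha.

(** The inverse of [zeta 1] is minus its image under F, so the difference is
    [zeta 1] plus that image in both diagonal blocks. It vanishes only if [zeta 1]
    has square 1. *)
Lemma torus_generator_trace (z : GLfix 0 (m * 2 ^ (1 + 0))) : val z = big_torus 1 (zeta 1) ->
  exists2 t : K, t != 0 & val z - val z^-1%g = t%:M.
Proof.
move=> Dz; have zP := zetaP (isT : (0 < 1)%N); have nz := zeta_neq0 (isT : (0 < 1)%N).
have zfz := mul_sfrob_root FtoK eta_sign dvd4 def_a zP.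
have ffz := iter_sfrob_period FtoK eta_sign dvd4 def_a (isT : (0 < 1)%N) zP.
have zV : (zeta 1)^-1 = - phi (zeta 1).
  by rewrite -[RHS](mulKf nz) mulrN zfz opprK mulr1.
exists (zeta 1 + phi (zeta 1)).
  rewrite -[phi _]opprK -zV subr_eq0; apply/negP=> /eqP zz.
  have: zeta 1 ^+ 2 == 1 by rewrite expr2 {2}zz mulfV.
  rewrite -(prim_order_dvd zP) (@dvdn_Pexp2l 2 _ 1) // addn1 ltnS leqNgt.
  by rewrite (leq_trans _ (a_ge2 FtoK eta_sign dvd4 def_a)).
rewrite GLfix_valV Dz big_torusV // zV big_torusN opprK -inflateD -inflate_scalar.
congr inflate; rewrite -conjg_mxD -(conjg_mx_scalar (g_unit (isT : (0 < 1)%N))).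
congr conjg_mx; rewrite /torus -linearD -diag_const_mx; congr diag_mx.
apply/rowP=> i; rewrite !mxE.
by case: i => [[|[|//]] ?] //=; rewrite -[phi (phi _)]/(iter (2 ^ 1) phi _) ffz addrC.
Qed.

(** As [w ^+ 2 = -1], the matrix (0 1; -1 0) is the inverse of [w], which acts on the
    torus as F does. *)
Lemma semidihedral_generator (z : GLfix 0 (m * 2 ^ (1 + 0))) :
  val z = big_torus 1 (zeta 1) -> exists v : GLfix 0 (m * 2 ^ (1 + 0)),
  [/\ val v = lastgen g m 0 (vmx K), val v *m val v = - 1%:M &
     val v *m val z = - (val z^-1%g *m val v)].
Proof.
move=> Dz; have zP := zetaP (isT : (0 < 1)%N); have nz := zeta_neq0 (isT : (0 < 1)%N).
have zfz := mul_sfrob_root FtoK eta_sign dvd4 def_a zP.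
have ffz := iter_sfrob_period FtoK eta_sign dvd4 def_a (isT : (0 < 1)%N) zP.
have [u Du] := shift_generator (isT : (0 < 1)%N).
have uu : val u *m val u = - 1%:M by rewrite Du -(big_shift_order (isT : (0 < 1)%N)).
have Dv : val u^-1%g = - val u.
  by rewrite GLfix_valV -[LHS]mulmx1 -[1%:M]opprK -uu mulmxN mulKmx ?GLfix_unit.
exists u^-1%g; rewrite Dv; split.
- by rewrite Du -inflateN /conjg_mx -mulNmx -mulmxN.
- by rewrite mulmxN mulNmx opprK.
have zV : (zeta 1)^-1 = - phi (zeta 1).
  by rewrite -[RHS](mulKf nz) mulrN zfz opprK mulr1.
rewrite GLfix_valV Dz big_torusV // zV big_torusN mulNmx mulmxN mulNmx opprK Du.
have := @big_shift_torus 1 isT 1 (phi (zeta 1)).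
rewrite !expr1 -[iter 1 _ _]/(iter (2 ^ 1) phi (zeta 1)) ffz => -> //.
by rewrite -{1}[phi (zeta 1)]/(iter 1 phi (zeta 1)) -iterD addnC iterD ffz.
Qed.

(** Shifting by half of the diagonal blocks amounts to applying F that many times,
    and this negates [zeta alpha.+2]. *)
Lemma half_shift_anticommute alpha (z : GLfix 0 (m * 2 ^ (alpha.+2 + 0))) :
  val z = big_torus alpha.+2 (zeta alpha.+2) ->
  exists x : GLfix 0 (m * 2 ^ (alpha.+2 + 0)),
  val x *m val x = - 1%:M /\ val z *m val x = - (val x *m val z).
Proof.
move=> Dz; have zP := zetaP (ltn0Sn alpha.+1).
have [u Du] := shift_generator (ltn0Sn alpha.+1).
exists (u ^+ (2 ^ alpha.+1))%g; rewrite GLfix_valX Du Dz; split.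
  by rewrite -(big_shift_order (ltn0Sn alpha.+1)) [in RHS]expnS mul2n -addnn exprD.
rewrite -big_shift_torus ?(iter_sfrob_half FtoK eta_sign dvd4 def_a zP) //.
  by rewrite big_torusN mulmxN.
exact: (iter_sfrob_period FtoK eta_sign dvd4 def_a _ zP).
Qed.

Lemma GLfix_detX N (x : GLfix 0 N) l : \det (val (x ^+ l)%g) = \det (val x) ^+ l.
Proof.
elim: l => [|l IHl]; first exact: det1.
by rewrite expgS GLfix_valM det_mulmx IHl exprS.
Qed.

Lemma signr_eq1 l : ((-1) ^+ l == 1 :> K) = ~~ odd l.
Proof.
rewrite -signr_odd; case: (odd l); rewrite ?eqxx //.
by rewrite expr1 -subr_eq0 -opprD oppr_eq0 (negPf two_neq0).
Qed.

Lemma cyclic_meet_SL N (z : GLfix 0 N) : \det (val z) = -1 ->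
  (<[z]> :&: SL FtoK eta N \subset <[z ^+ 2]>)%g.
Proof.
move=> dz; apply/subsetP=> _ /setIP[/cycleP[l ->]].
rewrite inE GLfix_detX dz signr_eq1 => l_even.
by rewrite -(even_halfK l_even) -mul2n expgM mem_cycle.
Qed.

(** The determinant of [z ^+ l] and of [z ^+ l * v] is 1 exactly for even [l]. *)
Lemma semidihedral_meet_SL N (z v : GLfix 0 N) h :
  (v ^+ 2 = z ^+ h)%g -> (v * z * v^-1 = z ^+ h * z^-1)%g ->
  \det (val z) = -1 -> \det (val v) = 1 ->
  (<<[set z; v]>> :&: SL FtoK eta N = <<[set z ^+ 2; v]>>)%g.
Proof.
move=> v2 vzv dz dv; apply/eqP; rewrite eqEsubset; apply/andP; split; last first.
  rewrite gen_subG; apply/subsetP=> x; rewrite !inE => /orP[] /eqP->.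
    by rewrite groupX ?mem_gen ?inE ?eqxx // GLfix_detX dz sqrrN expr1n /=.
  by rewrite mem_gen ?inE ?eqxx ?orbT // dv /=.
have [Sz Sv] : (z ^+ 2)%g \in <<[set z ^+ 2; v]>>%g /\ v \in <<[set z ^+ 2; v]>>%g.
  by split; apply: mem_gen; rewrite !inE eqxx ?orbT.
have even_in l : ~~ odd l -> (z ^+ l \in <<[set z ^+ 2; v]>>)%g.
  by move/even_halfK=> <-; rewrite -mul2n expgM groupX.
apply/subsetP=> r /setIP[/(semidihedral_elt v2 vzv)[/cycleP[l ->]|[l ->]]].
  by rewrite inE GLfix_detX dz signr_eq1; apply: even_in.
rewrite inE GLfix_valM det_mulmx GLfix_detX dz dv mulr1 signr_eq1 => l_even.
by rewrite groupM ?even_in.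
Qed.

(** For [alpha = 1] the eigenvalues of [z ^+ 2] are still distinct, which is what the
    relation [z - z^-1 = t] with [t] nonzero records. *)
Lemma special2_Rpos1 : odd m ->
  let R := Rpos FtoK eta zeta g m 1 0 in
  radical2 R (GL FtoK eta _) -> special2 R (GL FtoK eta _) (SL FtoK eta _).
Proof.
move=> m_odd R radR; have [z Dz] := torus_generator (isT : (0 < 1)%N).
have dz := torus_generator_det (isT : (0 < 1)%N) m_odd Dz.
have [t nzt zt] := torus_generator_trace Dz.
have DR : R = <[z]>%g := Rpos_cycle (isT : (0 < 1)%N) Dz.
have N_gt0 : (0 < m * 2 ^ (1 + 0))%N by rewrite muln_gt0 m_gt0.
have zh : val z ^+ (2 ^ a.-1 * 2) = - 1%:M.
  apply: (torus_generator_order (isT : (0 < 1)%N) Dz).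
  by rewrite addn1 -expnSr prednK // (leq_trans _ (a_ge2 FtoK eta_sign dvd4 def_a)).
apply: (@special2_norm _ _ [set: GLfix 0 _]%G (SL_group FtoK eta _) radR (GL_norm_SL _ _ _)).
rewrite setTI DR; apply: (norm_meet_cyclic N_gt0 two_neq0 nzt zt zh).
by rewrite inE GLfix_detX dz sqrrN expr1n.
Qed.

(** From [alpha = 2] on, half of the conjugates of [zeta] under F are the negatives of
    the others, so [z ^+ 2] has fewer eigenvalues than [z] and a larger centralizer. *)
Lemma not_special2_Rpos alpha : odd m ->
  ~ special2 (Rpos FtoK eta zeta g m alpha.+2 0) (GL FtoK eta _) (SL FtoK eta _).
Proof.
move=> m_odd /(@special2_norm_sub _ _ [set: GLfix 0 _]%G (SL_group FtoK eta _)).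
have [z Dz] := torus_generator (ltn0Sn alpha.+1).
have dz := torus_generator_det (ltn0Sn alpha.+1) m_odd Dz.
have [x [xx zx]] := half_shift_anticommute Dz.
rewrite (Rpos_cycle (ltn0Sn alpha.+1) Dz) setTI.
have N_gt0 : (0 < m * 2 ^ (alpha.+2 + 0))%N by rewrite muln_gt0 m_gt0 expn_gt0.
have zh : val z ^+ (2 ^ (a + alpha).-1 * 2 * 2) = - 1%:M.
  apply: (torus_generator_order (ltn0Sn alpha.+1) Dz).
  rewrite -mulnA -[(2 * 2)%N]/(2 ^ 2)%N -expnD !addnS addn0 prednK //.
  by rewrite ltn_addr // (leq_trans _ (a_ge2 FtoK eta_sign dvd4 def_a)).
exact: (not_norm_meet_cyclic N_gt0 two_neq0 xx zx zh (cyclic_meet_SL dz)).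
Qed.

Lemma Smx_gen (z v : GLfix 0 (m * 2 ^ (1 + 0))) :
  val z = big_torus 1 (zeta 1) -> val v = lastgen g m 0 (vmx K) ->
  Smx FtoK eta zeta g m 0 = <<[set z; v]>>%g.
Proof.
move=> Dz Dv; rewrite /Smx (Rpos_cycle (isT : (0 < 1)%N) Dz).
rewrite (_ : [set A | _] = [set v]); last first.
  by apply/setP=> A; rewrite !inE -Dv; apply: (inj_eq val_inj A v).
by rewrite -joingE joing_idl joingE.
Qed.

(** The element [z] has order [2 ^ a.+1], so that [z ^+ 2] is told apart by its order
    from the elements outside [<[z]>] exactly if [a] exceeds 2; otherwise the
    intersection is quaternion of order 8. *)
Lemma special2_Smx : odd m ->
  let R := Smx FtoK eta zeta g m 0 in
  radical2 R (GL FtoK eta _) -> special2 R (GL FtoK eta _) (SL FtoK eta _) <-> a <> 2%N.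
Proof.
move=> m_odd R radR; have [z Dz] := torus_generator (isT : (0 < 1)%N).
have dz := torus_generator_det (isT : (0 < 1)%N) m_odd Dz.
have [t nzt zt] := torus_generator_trace Dz.
have [v [Dv vv vz]] := semidihedral_generator Dz.
have dv : \det (val v) = 1 by rewrite Dv det_lastgen ?det_vmx // => ? /g_unit.
have N_gt0 : (0 < m * 2 ^ (1 + 0))%N by rewrite muln_gt0 m_gt0.
have DR : R = <<[set z; v]>>%g := Smx_gen Dz Dv.
have zH H : H = (2 ^ a)%N -> val z ^+ H = - 1%:M.
  by move=> DH; apply: (torus_generator_order (isT : (0 < 1)%N) Dz); rewrite addn1.
have a2 := a_ge2 FtoK eta_sign dvd4 def_a.
split=> [/(@special2_norm_sub _ _ [set: GLfix 0 _]%G (SL_group FtoK eta _)) sNN a_eq2 | a_neq2].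
  have z4 : val z ^+ 4 = - 1%:M by apply: zH; rewrite a_eq2.
  move: sNN; rewrite setTI DR; apply: (not_norm_meet_semidihedral N_gt0 two_neq0 z4 vv vz).
  have [v2 _ vzv] := semidihedral_relations z4 vv vz.
  exact: (semidihedral_meet_SL v2 vzv dz dv).
apply: (@special2_norm _ _ [set: GLfix 0 _]%G (SL_group FtoK eta _) radR (GL_norm_SL _ _ _)).
have zh : val z ^+ (2 ^ (a - 3) * 4 * 2) = - 1%:M.
  apply: zH; rewrite -mulnA -[(4 * 2)%N]/(2 ^ 3)%N -expnD subnK //.
  by rewrite ltn_neqAle a2 eq_sym andbT; apply/eqP.
rewrite setTI DR; apply: (norm_meet_semidihedral N_gt0 two_neq0 nzt zt zh vv vz).
  by rewrite inE GLfix_detX dz sqrrN expr1n.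
by rewrite inE dv.
Qed.

End Model.

(** * The classification *)

Lemma logn2_eq0 n : (0 < n)%N -> (logn 2 n == 0%N) = odd n.
Proof. by move=> n_gt0; rewrite lognE n_gt0 dvdn2; case: (odd n). Qed.

Theorem proposition4p38
  (p f : nat) (p_prime : prime p) (p_odd : odd p) (f_gt0 : (0 < f)%N)
  (Fq : finFieldType) (card_Fq : #|Fq| = (p ^ f)%N)
  (K : closedFieldType) (FtoK : {rmorphism Fq -> K}) (algK : integralRange FtoK)
  (eta : int) (eta_sign : eta = 1 \/ eta = -1)
  (dvd4 : (4 %| #|Fq|%:Z + eta)%Z)
  (a : nat) (def_a : a = logn 2 (absz (#|Fq|%:Z + eta)))
  (zeta : nat -> K)
  (zetaP : forall alpha, (0 < alpha)%N -> (2 ^ (a + alpha)).-primitive_root (zeta alpha))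
  (zeta4 : K) (zeta4P : 4.-primitive_root zeta4)
  (g : forall alpha, 'M[K]_(2 ^ alpha))
  (gP : forall alpha, (0 < alpha)%N ->
    \det (g alpha) = 1 /\
    invmx (g alpha) *m Frob FtoK eta (g alpha) = wmx K (2 ^ alpha))
  (m : nat) (m_gt0 : (0 < m)%N) (t : symptype) (t_ok : symptype_ok t) :
  let N := (m * 2 ^ (alpha_of t + gamma_of t))%N in
  let R := symp FtoK eta zeta zeta4 g m t in
  radical2 R (GL FtoK eta N) ->
  (special2 R (GL FtoK eta N) (SL FtoK eta N) <->
   [\/ exists alpha gamma,
         [/\ t = Std alpha gamma, (1 <= alpha)%N
            & (0 < logn 2 m + gamma)%N \/ alpha = 1%N],
      (exists2 gamma, (1 < gamma)%N & t = ExtPlus gamma) \/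
      (exists2 gamma, (0 < gamma)%N & t = ExtMinus gamma),
      exists gamma,
         [/\ t = Std 0 gamma, (1 <= gamma)%N
            & ~ [/\ logn 2 m = 0%N, gamma = 1%N & a = 2%N]]
    | t = Std 0 0]).
Proof.
move=> N R radR.
have ug := g_unit gP.
have in_SL : R \subset SL FtoK eta N ->
    special2 R (GL FtoK eta N) (SL FtoK eta N).
  exact: (@special2_sub _ _ [set: GLfix FtoK eta 0 N]%G (SL_group FtoK eta N)).
have m_parity : (logn 2 m == 0%N) = odd m by apply: logn2_eq0.
have even_deg gamma : (0 < logn 2 m + gamma)%N = ~~ odd (m * 2 ^ gamma).
  by rewrite lt0n addn_eq0 m_parity oddM oddX orbF.
have nzK alpha : (0 < alpha)%N ->
    \prod_(i < 2 ^ alpha) iter i (sfrob FtoK eta) (zeta alpha) = -1.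
  by move=> alpha_gt0; apply: (prod_iter_sfrob FtoK eta_sign dvd4 def_a) => //; apply: zetaP.
rewrite {}/R {}/N in radR in_SL *.
case: t t_ok radR in_SL => [[|alpha] gamma | gamma | gamma] /= t_ok radR in_SL.
- case: gamma radR in_SL => [|gamma] radR in_SL.
    split=> _; first by constructor 4.
    (* The subgroup consists of scalars, so that everything normalizes it. *)
    apply: (@special2_norm _ _ [set: GLfix FtoK eta 0 _]%G (SL_group FtoK eta _)
      radR (GL_norm_SL _ _ _)).
    apply/subsetP=> x _; rewrite inE; apply/subsetP=> _ /imsetP[r + ->].
    rewrite !inE => r_pm1; suff -> : (r ^ x = r)%g by [].
    apply: val_inj; case/orP: r_pm1 => /eqP r_scalar.
      by rewrite (val_conj_scalar _ r_scalar) [RHS]r_scalar.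
    by rewrite -raddfN in r_scalar; rewrite (val_conj_scalar _ r_scalar) [RHS]r_scalar.
  have [even_m|odd_m] := boolP (0 < logn 2 m + gamma)%N.
    split=> _.
      by constructor 3; exists gamma.+1; split=> // -[m0 [g0] _]; rewrite m0 g0 in even_m.
    apply/in_SL/Smx_sub_SL/Rpos_sub_SL; rewrite -?even_deg //; exact: nzK.
  move: odd_m radR in_SL; rewrite lt0n negbK addn_eq0 => /andP[m0 /eqP->] radR _.
  have m_odd : odd m by rewrite -m_parity.
  have := special2_Smx eta_sign dvd4 def_a zetaP gP m_gt0 m_odd radR.
  move=> ->; split=> [a_neq2|].
    by constructor 3; exists 1%N; split=> // -[].
  case=> [[al [ga [[<- _] //]]]|[[ga _ //]|[ga _ //]]|[ga [[<-] _ H]]|//] a2.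
  by apply: H; rewrite (eqP m0).
- have [even_m|odd_m] := boolP (0 < logn 2 m + gamma)%N.
    split=> _; first by constructor 1; exists alpha.+1, gamma; split=> //; left.
    apply/in_SL/Rpos_sub_SL; rewrite -?even_deg //; exact: nzK.
  move: (odd_m) radR; rewrite lt0n negbK addn_eq0 => /andP[m0 /eqP g0].
  rewrite {}g0 in odd_m in_SL * => radR.
  have m_odd : odd m by rewrite -m_parity.
  case: alpha radR in_SL => [|alpha] radR in_SL.
    split=> _; first by constructor 1; exists 1%N, 0%N; split=> //; right.
    exact: (special2_Rpos1 eta_sign dvd4 def_a zetaP gP m_gt0 m_odd radR).
  split=> [specR|].
    by case: (not_special2_Rpos eta_sign dvd4 def_a zetaP gP m_gt0 m_odd specR).
  by case=> [[al [ga [[<- <-] _ []]]]|[[ga _ //]|[ga _ //]]|[ga []]|] //; rewrite (negPf odd_m).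
- split=> _; first by constructor 2; left; exists gamma.
  exact/in_SL/Eplus_sub_SL.
split=> _; first by constructor 2; right; exists gamma.
apply/in_SL/Eminus_sub_SL => //.
by rewrite (prim_root_eq0 zeta4P).
Qed.
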